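(* Suppose $I \leq \omega$ and $\{\Gamma_i\}_{i \in I}$ is a set of countable discrete groups, and let $\ast_i \Gamma_i$ denote their free product. Let $\{A_i\}_{i \in I}$ be a Borel partition of $\operatorname{Free}((2^\omega)^{\ast_i \Gamma_i})$. Then there exist some $j \in I$ and an injective continuous function $f \colon \operatorname{Free}((2^\omega)^{\Gamma_j}) \to \operatorname{Free}((2^\omega)^{\ast_i \Gamma_i})$ that is $\Gamma_j$-equivariant with respect to the shift actions, and such that $\operatorname{ran}(f) \subseteq A_j$. Furthermore, $f$ can be chosen to be a Borel reduction between the orbit equivalence relations induced by the shift actions of $\Gamma_j$ on $\operatorname{Free}((2^\omega)^{\Gamma_j})$ and of $\ast_i \Gamma_i$ on $\operatorname{Free}((2^\omega)^{\ast_i \Gamma_i})$.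
   Context: $I \le \omega$ means that $I$ is a natural number (viewed as $\{0,\dots,I-1\}$) or $I=\omega$. For a countable discrete group $\Gamma$ and a Polish space $X$, $\Gamma$ acts on the Polish space $X^\Gamma$ (product topology) by the left shift action $(\gamma \cdot x)(\delta) = x(\gamma^{-1}\delta)$, and $\operatorname{Free}(X^\Gamma) = \{x \in X^\Gamma : \gamma \cdot x \neq x \text{ for all } 1 \ne \gamma \in \Gamma\}$. Each $\Gamma_j$ is viewed as a subgroup of $\ast_i \Gamma_i$ and so acts on $(2^\omega)^{\ast_i \Gamma_i}$; $f$ is $\Gamma_j$-equivariant if $f(\gamma \cdot x) = \gamma \cdot f(x)$ for all $\gamma \in \Gamma_j$ and all $x$. A Borel reduction from an equivalence relation $E$ on $X$ to $F$ on $Y$ is a Borel $f \colon X \to Y$ with $x \mathrel{E} y \iff f(x) \mathrel{F} f(y)$. *)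

(* Defs.v *)
From HB Require Import structures.
From mathcomp Require Import all_boot.
From mathcomp Require Import boolp classical_sets functions cardinality.
From mathcomp Require Import topology cantor measurable_structure.

Set Implicit Arguments.
Unset Strict Implicit.
Unset Printing Implicit Defensive.

Local Open Scope group_scope.
Local Open Scope classical_set_scope.

(* [Some n] stands for the natural number n = {0, ..., n - 1}, [None] for
   omega. *)
Definition below (I : option nat) (i : nat) : bool :=
  if I is Some n then (i < n)%N else true.

Definition index_type (I : option nat) : Type := {i : nat | below I i}.

HB.instance Definition _ (I : option nat) := Countable.on (index_type I).

Section Words.
Variables (I : choiceType) (G : I -> groupType).

Definition letter := {i : I & G i}.

Implicit Types (a b : letter) (v w : seq letter).

Definition reduced w :=
  all (fun a => tagged a != 1) w && sorted (fun a b => tag a != tag b) w.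

Definition cons_letter a w : seq letter :=
  if tagged a == 1 then w else
  if w is b :: w' then
    if tag a == tag b then
      let c := tagged a * tagged_as a b in
      if c == 1 then w' else Tagged G c :: w'
    else a :: w
  else [:: a].

Definition mul_word v w : seq letter := foldr cons_letter w v.

Definition inv_letter a : letter := Tagged G (tagged a)^-1.

Definition inv_word w : seq letter := rev (map inv_letter w).

Let headn i w := if w is b :: _ then i != tag b else true.

Let pcons i (x : G i) w :=
  if x == 1 then w else (Tagged G x : letter) :: w.

Let reduced_cons a w :
  reduced (a :: w) = [&& tagged a != 1, headn (tag a) w & reduced w].
Proof.
rewrite /reduced; case: w => [|b w] /=; first by rewrite !andbT.
by case: (tag a != tag b); rewrite /= ?andbF ?andbT -?andbA //= ?andbF.
Qed.

Let reduced_pcons i (x : G i) w :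
  headn i w -> reduced w -> reduced (pcons x w).
Proof.
rewrite /pcons; case: eqP => //= /eqP x1 hw rw.
by rewrite reduced_cons /= x1 hw rw.
Qed.

Let pconsP i w : reduced w ->
  exists x : G i, exists w', [/\ w = pcons x w', headn i w' & reduced w'].
Proof.
case: w => [|[j y] w] rw; first by exists 1, [::]; rewrite /pcons eqxx.
have [eij|nij] := eqVneq i j; last first.
  by exists 1, (existT _ j y :: w); rewrite /pcons eqxx.
case: _ / eij y rw => y; rewrite reduced_cons /= => /and3P[y1 hw rw].
by exists y, w; rewrite /pcons (negbTE y1).
Qed.

Let cons_pcons i (g x : G i) w : headn i w ->
  cons_letter (Tagged G g) (pcons x w) = pcons (g * x) w.
Proof.
move=> hw; rewrite /cons_letter /pcons /=.
have [->|g1] := eqVneq g 1; first by rewrite mul1g.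
have [->|x1] := eqVneq x 1; last by rewrite eqxx tagged_asE.
rewrite mulg1 (negbTE g1).
by case: w hw => [|b w] //= /negbTE->.
Qed.

Let cons1 i w : cons_letter (Tagged G (1 : G i)) w = w.
Proof. by rewrite /cons_letter eqxx. Qed.

Let consM i (g h : G i) w : reduced w ->
  cons_letter (Tagged G (g * h)) w =
  cons_letter (Tagged G g) (cons_letter (Tagged G h) w).
Proof.
by move=> /(pconsP i)[x [w' [-> hw rw]]]; rewrite !cons_pcons// mulgA.
Qed.

Lemma cons_letter_reduced a w : reduced w -> reduced (cons_letter a w).
Proof.
case: a => i g /(pconsP i)[x [w' [-> hw rw]]].
by rewrite cons_pcons//; exact: reduced_pcons.
Qed.

Lemma mul_word_reduced v w : reduced w -> reduced (mul_word v w).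
Proof. by move=> rw; elim: v => //= a v; exact: cons_letter_reduced. Qed.

Lemma mul_cons_letter a v w : reduced v -> reduced w ->
  mul_word (cons_letter a v) w = cons_letter a (mul_word v w).
Proof.
case: a => i g /(pconsP i)[x [v' [-> hv rv]]] rw; rewrite cons_pcons//.
have pE y : mul_word (pcons y v') w = cons_letter (Tagged G y) (mul_word v' w).
  by rewrite /pcons; case: eqP => [->|//]; rewrite cons1.
by rewrite !pE consM //; exact: mul_word_reduced.
Qed.

Lemma mul_wordA u v w : reduced v -> reduced w ->
  mul_word u (mul_word v w) = mul_word (mul_word u v) w.
Proof.
move=> rv rw; elim: u => //= a u IHu.
by rewrite mul_cons_letter ?IHu//; exact: mul_word_reduced.
Qed.

Lemma mul_word_nil w : reduced w -> mul_word w [::] = w.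
Proof.
elim: w => //= a w IHw; rewrite reduced_cons => /and3P[a1 hw rw].
by rewrite IHw// /cons_letter (negbTE a1); case: w hw {IHw rw} => //= b w /negbTE->.
Qed.

Lemma inv_wordK : involutive inv_word.
Proof.
move=> w; rewrite /inv_word map_rev revK -map_comp -[RHS]map_id.
by apply: eq_map => -[i g]; rewrite /inv_letter /= invgK.
Qed.

Lemma inv_word_reduced w : reduced w -> reduced (inv_word w).
Proof.
case/andP=> w1 sw; apply/andP; split.
  rewrite all_rev all_map; apply: sub_all w1 => a /=.
  by rewrite invg_eq1.
rewrite rev_sorted sorted_map; apply: sub_sorted sw => a b /=.
by rewrite eq_sym.
Qed.

Lemma mul_inv_word v w : reduced w -> mul_word (inv_word v) (mul_word v w) = w.
Proof.
move=> rw; elim: v => //= -[i g] v IHv.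
rewrite /inv_word /= rev_cons /mul_word foldr_rcons -/(inv_word v).
by rewrite -consM ?mulVg ?cons1 ?IHv//; exact: mul_word_reduced.
Qed.

(* The free product as the group of reduced words: no letter is trivial and
   adjacent letters come from different factors; the empty word is the unit.
   [fp_universal] below shows that this is the coproduct of groups. *)
Record free_product := FreeProduct {
  fp_word :> seq letter;
  fp_reduced : reduced fp_word
}.

HB.instance Definition _ := [isSub for fp_word].
HB.instance Definition _ := [Choice of free_product by <:].

Definition fp_one := @FreeProduct [::] isT.
Definition fp_mul (x y : free_product) :=
  FreeProduct (mul_word_reduced x (fp_reduced y)).
Definition fp_inv (x : free_product) :=
  FreeProduct (inv_word_reduced (fp_reduced x)).

Let fp_mulA : associative fp_mul.
Proof. by move=> [u ru] [v rv] [w rw]; apply: val_inj; exact: mul_wordA. Qed.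

Let fp_mul1g : left_id fp_one fp_mul.
Proof. by move=> x; exact: val_inj. Qed.

Let fp_mulg1 : right_id fp_one fp_mul.
Proof. by move=> [w rw]; apply: val_inj; exact: mul_word_nil. Qed.

Let fp_mulVg : left_inverse fp_one fp_inv fp_mul.
Proof.
move=> [w rw]; apply: val_inj => /=.
by rewrite -{2}[w]mul_word_nil// mul_inv_word.
Qed.

Let fp_mulgV : right_inverse fp_one fp_inv fp_mul.
Proof.
by move=> x; rewrite -(fp_mulVg (fp_inv x)); congr fp_mul;
  apply: val_inj; rewrite /= inv_wordK.
Qed.

HB.instance Definition _ :=
  isGroup.Build free_product fp_mulA fp_mul1g fp_mulg1 fp_mulVg fp_mulgV.

Lemma fp_of_subproof i (g : G i) : reduced (cons_letter (Tagged G g) [::]).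
Proof. exact: cons_letter_reduced. Qed.

Definition fp_of i (g : G i) : free_product :=
  FreeProduct (fp_of_subproof g).

Lemma fp_of_is_monoid_morphism i : monoid_morphism (@fp_of i).
Proof.
split=> [|g h]; apply: val_inj => /=; first by rewrite cons1.
by rewrite consM// mul_cons_letter//; exact: fp_of_subproof.
Qed.

HB.instance Definition _ i :=
  isUMagmaMorphism.Build (G i) free_product (@fp_of i)
    (fp_of_is_monoid_morphism i).

Lemma fp_of_inj i : injective (@fp_of i).
Proof.
move=> g h /(congr1 fp_word); rewrite /= /cons_letter /=.
have [->|g1] := eqVneq g 1; have [->|h1] := eqVneq h 1 => //.
by case=> /(congr1 (tagged_as (Tagged G g))); rewrite !tagged_asE.
Qed.

Lemma fp_universal (H : groupType) (phi : forall i, G i -> H) :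
  (forall i, monoid_morphism (phi i)) ->
  exists! f : free_product -> H,
    monoid_morphism f /\ forall i g, f (fp_of g) = phi i g.
Proof.
move=> phiM; pose F w := foldr (fun a x => phi (tag a) (tagged a) * x) 1 w.
have Fcons a w : reduced w ->
    F (cons_letter a w) = phi (tag a) (tagged a) * F w.
  case: a => i g /(pconsP i)[x [w' [-> hw rw]]]; rewrite cons_pcons//.
  have pE y : F (pcons y w') = phi i y * F w'.
    by rewrite /pcons; case: eqP => [->|//]; rewrite (phiM i).1 mul1g.
  by rewrite !pE (phiM i).2 mulgA.
exists (F \o fp_word); split=> [|f [[f1 fM] fE]].
  split; last by move=> i g; rewrite /= Fcons//= mulg1.
  split=> // -[v rv] [w rw] /=; rewrite /mul_word; elim: v {rv} => [|a v IHv] /=.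
    by rewrite mul1g.
  by rewrite Fcons ?IHv ?mulgA//; exact: mul_word_reduced.
apply/funext => -[w rw] /=; elim: w rw => [|[i g] w IHw] rw.
  by rewrite /= -f1; congr f; exact: val_inj.
have rw' : reduced w by move: rw; rewrite reduced_cons => /and3P[].
rewrite /= (IHw rw') -fE -fM; congr f; apply: val_inj => /=.
rewrite mul_cons_letter//=; move: rw; rewrite reduced_cons /= => /and3P[g1 hw _].
by rewrite /cons_letter (negbTE g1); case: w hw {IHw rw'} => //= b w /negbTE->.
Qed.

End Words.

Arguments free_product {I} G.
Arguments fp_of {I G i} g.

Section Shift.
Variables (X : topologicalType) (G : groupType).

(* G carries the discrete topology, so X^G is a product of copies of X. *)
Definition shift_space : Type := {ptws G -> X}.

HB.instance Definition _ := Topological.copy shift_space {ptws G -> X}.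

Definition shift (g : G) (x : shift_space) : shift_space :=
  fun h => x (g^-1 * h).

Lemma shift1 x : shift 1 x = x.
Proof. by apply/funext => h; rewrite /shift invg1 mul1g. Qed.

Lemma shiftM g h x : shift (g * h) x = shift g (shift h x).
Proof. by apply/funext => k; rewrite /shift invgM mulgA. Qed.

Definition free_part : set shift_space :=
  [set x | forall g : G, g <> 1 -> shift g x <> x].

Definition Free : Type := set_type free_part.

HB.instance Definition _ := Topological.copy Free (set_type free_part).

Lemma free_part_shift g (x : Free) : shift g (val x) \in free_part.
Proof.
apply/mem_set => h h1; rewrite -shiftM => /(congr1 (shift g^-1)).
rewrite -!shiftM mulVg shift1; apply: (set_mem (valP x)) => ghg.
apply: h1; apply: (@mulgI _ g^-1); apply: (@mulIg _ g).
by rewrite mulg1 mulVg -mulgA.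
Qed.

Definition free_shift (g : G) (x : Free) : Free :=
  exist _ (shift g (val x)) (free_part_shift g x).

Definition orbit_rel (x y : Free) : Prop := exists g : G, free_shift g x = y.

End Shift.

Definition Borel (T : topologicalType) : set (set T) := <<s [set U | open U] >>.
Arguments Borel {T}.

Definition Borel_function (S T : topologicalType) (f : S -> T) : Prop :=
  forall B : set T, Borel B -> Borel (f @^-1` B).

Definition Borel_reduction (S T : topologicalType)
    (E : S -> S -> Prop) (F : T -> T -> Prop) (f : S -> T) : Prop :=
  Borel_function f /\ forall x y, E x y <-> F (f x) (f y).

(* The library's [partition] additionally requires nonempty pieces; here the
   pieces are indexed and may be empty. *)
Definition Borel_partition (J : Type) (T : topologicalType) (A : J -> set T) :
    Prop :=
  [/\ forall j, Borel (A j), trivIset [set: J] A & cover [set: J] A = [set: T]].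

Definition equivariant (G H : groupType) (X Y : topologicalType)
    (phi : G -> H) (f : Free X G -> Free Y H) : Prop :=
  forall g x, f (free_shift g x) = free_shift (phi g) (f x).

(* Main.v *)
(* For every factor j consider a game building a point y of (2^omega)^Gamma, in
   which player j chooses the bits of y at the words starting in Gamma_j together
   with her share of the bits at the identity, and a team of all other players
   chooses the remaining bits. The team wins if y lies in A_j. If for every j
   player j could avoid A_j, then letting all of them play simultaneously would
   produce a point outside all the A_j. Hence, by Borel determinacy, the team wins
   for some j. Given x, letting the team follow its strategy at every vertex of
   the subgroup Gamma_j of Gamma at once, while player j inserts x at those
   vertices, yields a point f(x) all of whose Gamma_j-translates lie in A_j, and f
   is Gamma_j-equivariant.

   For f(x) to be free the partition is first extended to the non-free points, in
   such a way that no free Gamma_j-orbit lies entirely in the j-th piece. For f to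
   be a reduction, x is inserted through codes that the strategy cannot predict at
   other places: a translate of f(x) by an element outside Gamma_j would contain
   the code of some x', which the strategy would have had to guess unless x' is a
   translate of x.

   Borel determinacy is proved by Martin's inductive method of unraveling. *)

Require Import Defs.
From mathcomp Require Import all_boot.
From mathcomp Require Import boolp classical_sets functions cardinality.
From mathcomp Require Import topology cantor.
From mathcomp Require Import filter measurable_structure.

Set Implicit Arguments.
Unset Strict Implicit.
Unset Printing Implicit Defensive.

Local Open Scope classical_set_scope.

(** * Games on trees *)

(** The heavier a word, the later its bits are played. This makes the copies of the strategy
    compatible: seen from the next vertex of the orbit the word loses its first letter, so a bit
    that player [j] owes has already been played there. Inserting the bits of [x] directly would
    give an equivariant map, but the strategy could copy them to other orbits of the factor. So the
    bits at the identity are cut into blocks, the [k]-th of which carries a code of finitely many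
    bits of information on [x]. When the strategy fills block [k] at a fixed place, it has seen
    blocks up to [k] at finitely many vertices only. Unpredictability is thus a finite set of
    constraints on the code, and counting satisfies them all. A correct guess then means that the
    symbol of the target was seen: at each stage some translate of [x] by an element of a finite
    window has this symbol. For these elements to stabilise, the symbols must separate the
    translates over the window within a number of bits independent of [x]; this is the reason for
    the colourings and parities. *)

(* A game is a pruned tree of positions, given by the parent map. Strategies are
   total maps on positions and serve both players: player [false] moves at even
   levels and player [true] at odd ones. *)
Record game := Game {
  pos :> Type;
  par : pos -> pos;
  lev : pos -> nat;
  root : pos;
  lev_root : lev root = 0;
  lev_eq0 : forall p, lev p = 0 -> p = root;
  lev_par : forall p, lev (par p) = (lev p).-1;
  child_ex : forall p, exists q, par q = p /\ lev q = (lev p).+1 }.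

Section Trees.
Variable T : game.
Implicit Types (p q r : T) (x y : nat -> T) (s : T -> T).

Definition child q p := par q = p /\ lev q = (lev p).+1.
Definition ancestor m p : T := iter (lev p - m) (@par T) p.
Definition is_play x := x 0 = root T /\ forall n, child (x n.+1) (x n).
Definition valid s := forall p, child (s p) p.
Definition follows (b : bool) s N x :=
  forall n, N <= n -> odd n = b -> x n.+1 = s (x n).

Lemma ancestorE m p : lev p <= m -> ancestor m p = p.
Proof. by rewrite -subn_eq0 /ancestor => /eqP->. Qed.

Lemma child_ancestor q p m : child q p -> m <= lev p -> ancestor m q = ancestor m p.
Proof. by case=> <- e; rewrite /ancestor e => h; rewrite subSn // iterSr. Qed.

Lemma lev_ancestor m p : m <= lev p -> lev (ancestor m p) = m.
Proof.
have h n : lev (iter n (@par T) p) = lev p - n.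
  by elim: n => [|n IH] /=; rewrite ?subn0 // lev_par IH subnS.
by move=> ?; rewrite h subKn.
Qed.

Lemma child_par p : 0 < lev p -> child p (par p).
Proof. by move=> h; split=> //; rewrite lev_par prednK. Qed.

Lemma ancestor_ancestor m n p : m <= n -> ancestor m (ancestor n p) = ancestor m p.
Proof.
move=> mn; have [pn|np] := leqP (lev p) n; first by rewrite (ancestorE pn).
rewrite {1}/ancestor lev_ancestor; last exact: ltnW.
by rewrite /ancestor -iterD; congr iter; rewrite addnC addnBA // subnK // ltnW.
Qed.

Lemma par_ancestor m p : m < lev p -> par (ancestor m.+1 p) = ancestor m p.
Proof. by move=> h; rewrite /ancestor -iterS subnSK. Qed.

Lemma play_lev x n : is_play x -> lev (x n) = n.
Proof. by case=> x0 xc; elim: n => [|n IH]; [rewrite x0 lev_root | rewrite (xc n).2 IH]. Qed.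

Lemma play_ancestor x m n : is_play x -> m <= n -> ancestor m (x n) = x m.
Proof.
move=> xp; elim: n => [|n IH]; first by rewrite leqn0 => /eqP->; rewrite ancestorE // play_lev.
rewrite leq_eqVlt => /orP[/eqP->|mn]; first by rewrite ancestorE // play_lev.
by rewrite (child_ancestor (xp.2 n)) ?IH // play_lev.
Qed.

Lemma valid_ex : exists s, valid s.
Proof. by have [s h] := choice (@child_ex T); exists s. Qed.

Definition default_strategy := sval (cid valid_ex).
Lemma default_strategyP : valid default_strategy. Proof. exact: svalP (cid valid_ex). Qed.

(* [switch N Q s t] plays [s] until, at a level at least [N], a position [a] in [Q]
   is met, and [t a] from then on. *)
Definition switch N (Q : set T) s (t : T -> T -> T) r :=
  let m := find (fun m => (N <= m) && `[< Q (ancestor m r) >]) (iota 0 (lev r).+1) in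
  if m <= lev r then t (ancestor m r) r else s r.

Lemma switch_hit N Q s t x i n : is_play x -> N <= i <= n -> Q (x i) ->
  (forall j, N <= j < i -> ~ Q (x j)) -> switch N Q s t (x n) = t (x i) (x n).
Proof.
move=> xp /andP[Ni le_in] Qi Hi; rewrite /switch.
set P := fun m => _; suff -> : find P (iota 0 (lev (x n)).+1) = i.
  by rewrite play_lev // le_in play_ancestor.
rewrite play_lev //; have Pi : P i by rewrite /P Ni play_ancestor //; exact/asboolP.
have hP : has P (iota 0 n.+1) by apply/hasP; exists i => //; rewrite mem_iota.
have lt_f : find P (iota 0 n.+1) < n.+1 by rewrite -[X in _ < X](size_iota 0) -has_find.
apply/eqP; rewrite eqn_leq; apply/andP; split.
  rewrite leqNgt; apply/negP => /(before_find 0); rewrite nth_iota //.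
  by rewrite add0n Pi.
rewrite leqNgt; apply/negP => lt_fi.
have := nth_find 0 hP; rewrite nth_iota // add0n /P => /andP[h1 /asboolP].
by rewrite play_ancestor //; apply: Hi; rewrite h1.
Qed.

Lemma switch_miss N Q s t x n : is_play x ->
  (forall j, N <= j <= n -> ~ Q (x j)) -> switch N Q s t (x n) = s (x n).
Proof.
move=> xp H; rewrite /switch ifF // play_lev //.
apply/negbTE; rewrite -ltnNge -{1}[n.+1](size_iota 0) leqNgt -has_find.
apply/hasPn => j; rewrite mem_iota add0n /= ltnS => jn.
apply/negP => /andP[Nj /asboolP]; rewrite play_ancestor //; apply: H; exact/andP.
Qed.

Lemma switch_low N Q s t p : lev p < N -> switch N Q s t p = s p.
Proof.
move=> pN; rewrite /switch ifF //; apply/negbTE.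
rewrite -ltnNge -{1}[(lev p).+1](size_iota 0) leqNgt -has_find.
apply/hasPn => j; rewrite mem_iota add0n /= ltnS => jp.
by rewrite leqNgt (leq_ltn_trans jp pN).
Qed.

Lemma switch_valid N Q s t : valid s -> (forall a, valid (t a)) -> valid (switch N Q s t).
Proof. by move=> vs vt p; rewrite /switch; case: ifP => _; [exact: vt | exact: vs]. Qed.

Lemma eq_switch N Q s t s' t' p : s p = s' p ->
  (forall a, lev a <= lev p -> t a p = t' a p) ->
  switch N Q s t p = switch N Q s' t' p.
Proof.
by move=> es et; rewrite /switch; case: ifP => // h; apply: et; rewrite lev_ancestor.
Qed.

Lemma first_level N (Q : set T) x : (exists2 n, N <= n & Q (x n)) ->
  exists n, [/\ N <= n, Q (x n) & forall j, N <= j < n -> ~ Q (x j)].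
Proof.
case=> n0 h1 h2; pose P n := (N <= n) && `[< Q (x n) >].
have exP : exists n, P n by exists n0; apply/andP; split => //; exact/asboolP.
case: (ex_minnP exP) => n /andP[Nn /asboolP Qn] Hn; exists n; split=> // j /andP[Nj jn] Qj.
by have := Hn j; rewrite /P Nj (asboolT Qj) leqNgt jn => /(_ isT).
Qed.

(** The attractor of player [b]. The derivation tree plays the part of an ordinal rank, and failure
    of [force] is a local condition that can be maintained move by move ([nforce_own],
    [nforce_other]). *)
Inductive force (b : bool) (R V : set T) : T -> Prop :=
| ForceHit p : R p -> V p -> force b R V p
| ForceMine p q : R p -> odd (lev p) = b -> child q p -> force b R V q -> force b R V p
| ForceOpp p : R p -> odd (lev p) <> b ->
    (forall q, child q p -> force b R V q) -> force b R V p.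

Lemma force_reach b R V p : force b R V p ->
  exists u, [/\ R u, V u, lev p <= lev u & ancestor (lev p) u = p].
Proof.
elim=> {p} [p Rp Vp|p q Rp _ cq _ [u [Ru Vu lu au]]|p Rp _ _ IH].
- by exists p; rewrite ancestorE.
- have lpu : lev p < lev u by rewrite -cq.2.
  exists u; split=> //; first exact: ltnW.
  by rewrite -par_ancestor // -cq.2 au cq.1.
- have [q [pq lq]] := child_ex p; have [u [Ru Vu lu au]] := IH q (conj pq lq).
  have lpu : lev p < lev u by rewrite -lq.
  exists u; split=> //; first exact: ltnW.
  by rewrite -par_ancestor // -lq au.
Qed.

(** The strategy has to be obeyed only until [V] is met, because the strategies built by [switch]
    change over at that moment. *)
Definition wins_from b R V p s := forall x, is_play x -> x (lev p) = p ->
  (forall n, lev p <= n -> (forall j, lev p <= j <= n -> ~ V (x j)) ->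
     odd n = b -> x n.+1 = s (x n)) ->
  exists m, [/\ lev p <= m, V (x m) & forall j, lev p <= j <= m -> R (x j)].

Lemma wins_hit b (R V : set T) p s : R p -> V p -> wins_from b R V p s.
Proof.
move=> Rp Vp x px xp _; exists (lev p); rewrite xp; split=> // j.
by rewrite -eqn_leq => /eqP<-; rewrite xp.
Qed.

Lemma wins_child b (R V : set T) p q s s' x : R p -> ~ V p -> child q p ->
  wins_from b R V q s' -> is_play x -> x (lev p) = p -> x (lev q) = q ->
  (forall n, lev p <= n -> (forall j, lev p <= j <= n -> ~ V (x j)) ->
     odd n = b -> x n.+1 = s (x n)) ->
  (forall n, lev q <= n -> s (x n) = s' (x n)) ->
  exists m, [/\ lev p <= m, V (x m) & forall j, lev p <= j <= m -> R (x j)].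
Proof.
move=> Rp nVp cq Hs px xp xq Hx ss'.
have [|m [h1 h2 h3]] := Hs x px xq.
  move=> n qn nV on; rewrite Hx ?ss' //; first by apply: leq_trans qn; rewrite cq.2.
  move=> j /andP[]; rewrite leq_eqVlt => /orP[/eqP<- _|pj jn]; first by rewrite xp.
  by apply: nV; rewrite cq.2 pj.
exists m; split=> //; first by apply: leq_trans h1; rewrite cq.2.
move=> j /andP[]; rewrite leq_eqVlt => /orP[/eqP<- _|pj jn]; first by rewrite xp.
by apply: h3; rewrite cq.2 pj.
Qed.

Lemma force_strategy b R V p : force b R V p ->
  exists s, valid s /\ wins_from b R V p s.
Proof.
elim=> {p} [p Rp Vp|p q Rp ob cq _ [s [vs Hs]]|p Rp ob _ IH].
- by exists default_strategy; split; [exact: default_strategyP | exact: wins_hit].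
- pose t r := if pselect (r = p) then q else s r; exists t; split.
    by move=> r; rewrite /t; case: pselect => [e|_] /=; [rewrite e|].
  have [Vp|nVp] := pselect (V p); first exact: wins_hit.
  move=> x px xp Hx.
  have xq : x (lev q) = q.
    rewrite cq.2 Hx ?xp //; first by rewrite /t; case: pselect.
    by move=> j; rewrite -eqn_leq => /eqP<-; rewrite xp.
  apply: (wins_child Rp nVp cq Hs px xp xq Hx) => n qn.
  by rewrite /t; case: (pselect (x n = p)) => //= e; move: qn; rewrite cq.2 -e play_lev // ltnn.
- have /choice[F HF] : forall q, exists s, child q p -> valid s /\ wins_from b R V q s.
    by move=> q; have [/IH[s Hs]|n] := pselect (child q p); [exists s|exists default_strategy].
  pose G q := if pselect (child q p) then F q else default_strategy.
  set t := switch (lev p).+1 setT default_strategy G; exists t; split.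
    apply: switch_valid => [|a]; first exact: default_strategyP.
    by rewrite /G; case: (pselect (child a p)) => [/HF[]|n] //=; exact: default_strategyP.
  have [Vp|nVp] := pselect (V p); first exact: wins_hit.
  move=> x px xp Hx.
  have cq : child (x (lev p).+1) p by rewrite -{2}xp; exact: px.2.
  apply: (wins_child Rp nVp cq (HF _ cq).2 px xp _ Hx); first by rewrite cq.2.
  move=> n; rewrite cq.2 => pn.
  rewrite /t (@switch_hit _ _ _ _ _ (lev p).+1) ?leqnn //.
    by rewrite /G; case: (pselect (child _ p)).
  by move=> j /andP[h1 h2]; move: (leq_trans h2 h1); rewrite ltnn.
Qed.

Lemma nforce_own b R V p q : R p -> ~ force b R V p -> odd (lev p) = b ->
  child q p -> ~ force b R V q.
Proof. by move=> Rp nf ob cq fq; apply: nf; exact: ForceMine cq fq. Qed.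

Lemma nforce_other b R V p : R p -> ~ force b R V p -> odd (lev p) <> b ->
  exists2 q, child q p & ~ force b R V q.
Proof.
move=> Rp nf ob; apply: contrapT => H; apply: nf; apply: ForceOpp => // q cq.
by apply: contrapT => nq; apply: H; exists q.
Qed.

Definition open_set (A : set (nat -> T)) := forall x, is_play x -> A x ->
  exists n, forall x', is_play x' -> x' n = x n -> A x'.

Definition clopen_set A := open_set A /\ open_set (~` A).

End Trees.

(** * Unraveling open sets *)

(* Martin's coverings: plays of [T] that follow the image of a strategy lift to
   plays of [T'] that follow the strategy, and the image of a strategy up to
   level [n] depends on the strategy up to level [n] only. The two games coincide
   up to level [k]. *)
Record covering (k : nat) (T' T : game) := Covering {
  cov_map : T' -> T;
  cov_map_lev : forall p, lev (cov_map p) = lev p;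
  cov_map_par : forall p, cov_map (par p) = par (cov_map p);
  cov_map_inj : forall p q, lev p <= k -> cov_map p = cov_map q -> p = q;
  cov_map_surj : forall q, lev q <= k -> exists p, cov_map p = q;
  cov_strategy : bool -> (T' -> T') -> T -> T;
  cov_strategy_valid : forall b s, valid s -> valid (cov_strategy b s);
  cov_strategy_loc : forall b s s' n, (forall p, lev p <= n -> s p = s' p) ->
    forall p, lev p <= n -> cov_strategy b s p = cov_strategy b s' p;
  cov_strategy_low : forall b s p, valid s -> lev p < k -> cov_strategy b s (cov_map p) = cov_map (s p);
  cov_strategy_lift : forall b s x, valid s -> is_play x -> follows b (cov_strategy b s) 0 x ->
    exists x', [/\ is_play x', follows b s 0 x' & forall n, cov_map (x' n) = x n] }.

Record game_map (T' T : game) := GameMap {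
  game_map_fun :> T' -> T;
  game_map_lev : forall p, lev (game_map_fun p) = lev p;
  game_map_par : forall p, game_map_fun (par p) = par (game_map_fun p) }.

Definition cov_game_map k T' T (c : covering k T' T) := GameMap (cov_map_lev c) (cov_map_par c).

Lemma game_map_play T' T (m : game_map T' T) x : is_play x -> is_play (m \o x).
Proof.
case=> x0 xc; split=> [|n] /=; first by apply: lev_eq0; rewrite game_map_lev x0 lev_root.
by split=> /=; [rewrite -game_map_par (xc n).1 | rewrite !game_map_lev (xc n).2].
Qed.

Section ClosedUnraveling.
Variables (T : game) (K : nat) (W : set T).
Implicit Types (p q u a : T) (U : set T) (o : option T).
Hypothesis evenK : ~~ odd K.

Definition comparable p u :=
  (lev p <= lev u -> ancestor (lev p) u = p) /\ (lev u <= lev p -> ancestor (lev u) p = u).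

Definition target p := W p /\ K.+1 < lev p.
(** Where [avoidI U] holds, player [false] can keep a promise never to enter [U]. In [loseII U] she
    can moreover force the target while keeping it, so a promise of player [true] to avoid the
    target is untenable there. *)
Definition avoidI U p := ~ force true setT (fun p => U p /\ K.+1 < lev p) p.
Definition loseII U := force false (avoidI U) target.

(* Positions of the auxiliary game. With her move at level [K], player [false]
   promises never to enter [U]; with his move at level [K.+1], player [true]
   either names a point [o = Some u] of the target outside [U], through which the
   play has to pass, or promises ([o = None]) never to enter the target. From then
   on only moves that keep the promises tenable are legal; below the level at
   which they are chosen, [U] and [o] have the dummy values [set0] and [None]. *)
Definition legal p U o :=
  [/\ lev p <= K -> U = set0, lev p <= K.+1 -> o = None,
      K < lev p -> avoidI U (ancestor K.+1 p) &
      K.+1 < lev p -> if o is Some u then [/\ target u, ~ U u & comparable p u]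
      else forall m, K.+1 < m <= lev p ->
             avoidI U (ancestor m p) /\ ~ loseII U (ancestor m p)].

Lemma play_comparable x m n : is_play x -> comparable (x m) (x n).
Proof. by move=> px; split; rewrite !play_lev // => h; rewrite play_ancestor. Qed.

Lemma comparable_par p u : 0 < lev p -> comparable p u -> comparable (par p) u.
Proof.
move=> p0 [h1 h2]; split; rewrite lev_par => h.
  have [pu|up] := leqP (lev p) (lev u).
    by rewrite -(par_ancestor (m := (lev p).-1)) prednK // h1.
  have eu : lev u = (lev p).-1 by apply/eqP; rewrite eqn_leq h -ltnS prednK // up.
  rewrite -eu ancestorE // -(h2 (ltnW up)) eu -(par_ancestor (m := (lev p).-1)) ?prednK //.
  by rewrite ancestorE.
rewrite -(child_ancestor (child_par p0)) ?lev_par // h2 //.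
by apply: leq_trans h _; rewrite leq_pred.
Qed.

Lemma legal_par p U o : legal p U o ->
  legal (par p) (if lev p <= K.+1 then set0 else U)
                (if lev p <= K.+2 then None else o).
Proof.
case=> h1 h2 h3 h4; split; rewrite lev_par.
- by move=> h; rewrite ifT // -ltnS; case: (lev p) h.
- by move=> h; rewrite ifT //; case: (lev p) h.
- move=> h; have p0 : 0 < lev p by case: (lev p) h.
  have hp : K.+1 < lev p by case: (lev p) h.
  rewrite leqNgt hp /= -(child_ancestor (child_par p0)) ?lev_par //.
  by apply: h3; exact: ltnW.
- move=> h; have p0 : 0 < lev p by case: (lev p) h.
  have hp : K.+2 < lev p by case: (lev p) h.
  have -> : (lev p <= K.+1) = false by rewrite leqNgt (ltnW hp).
  have -> : (lev p <= K.+2) = false by rewrite leqNgt hp.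
  have := h4 (ltnW hp); case: o {h2 h4} => [u [? ? cu]|h4 m /andP[m1 m2]].
    by split=> //; exact: comparable_par.
  rewrite -(child_ancestor (child_par p0)) ?lev_par //; apply: h4; rewrite m1 /=.
  by apply: leq_trans m2 (leq_pred _).
Qed.

Lemma avoidI_target U u : avoidI U u -> target u -> ~ U u.
Proof. by move=> h [_ lu] Uu; apply: h; apply: ForceHit. Qed.

Lemma loseII_target U u : avoidI U u -> target u -> loseII U u.
Proof. exact: ForceHit. Qed.

Lemma avoidI_II U p q : avoidI U p -> odd (lev p) -> child q p -> avoidI U q.
Proof. by move=> h op; apply: nforce_own h op. Qed.

Definition legal_triple (t : T * set T * option T) := legal t.1.1 t.1.2 t.2.
Let pos' := {t | legal_triple t}.
Let mk p U o (h : legal p U o) : pos' := exist legal_triple (p, U, o) h.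
Let par' (t : pos') : pos' := mk (legal_par (svalP t)).
Let lev' (t : pos') := lev (sval t).1.1.

Let sval_inj' (t t' : pos') : sval t = sval t' -> t = t'.
Proof.
by case: t t' => [t h] [t' h'] /= e; case: _ / e h' => h'; rewrite (Prop_irrelevance h h').
Qed.

Lemma legal_low p : lev p < K.+1 -> legal p set0 None.
Proof.
move=> h; split=> //.
- by move=> h'; move: (leq_ltn_trans h' h); rewrite ltnn.
- by move=> h'; move: (ltn_trans h' h); rewrite ltnn.
Qed.

Lemma legal_root : legal (root T) set0 None.
Proof. by apply: legal_low; rewrite lev_root. Qed.

Let root' : pos' := mk legal_root.

Let lev_eq0' t : lev' t = 0 -> t = root'.
Proof.
case: t => [[[p U] o] h]; rewrite /lev' /= => l0; apply: sval_inj' => /=.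
by case: (h) => /=; rewrite l0 (lev_eq0 l0) => -> // ->.
Qed.

Let child_ex' t : exists t', par' t' = t /\ lev' t' = (lev' t).+1.
Proof.
case: t => [[[p U] o] h]; rewrite /lev' /=.
suff [q [U' [o' [h' cq eU eo]]]] : exists q U' o', [/\ legal q U' o', child q p,
    (if lev p <= K then set0 else U') = U & (if lev p <= K.+1 then None else o') = o].
  exists (mk h'); split; last by rewrite /= cq.2.
  by apply: sval_inj' => /=; rewrite cq.1 cq.2 !ltnS eU eo.
case: (h) => /= h1 h2 h3 h4.
have [pK|Kp] := leqP (lev p) K.
  (* The empty set can always be promised, which also settles the move at level [K]. *)
  have [q cq] := child_ex p; exists q, set0, None.
  rewrite h1 // h2 ?leqW //; split=> //; try by case: ifP.
  split; rewrite ?cq.2 ?ltnS //.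
  - by move=> _ /force_reach[u [_ []]].
  - by move=> Kp; move: (leq_trans Kp pK); rewrite ltnn.
have Ap := h3 Kp.
have [pK1|K1p] := leqP (lev p) K.+1.
  have e : lev p = K.+1 by apply/eqP; rewrite eqn_leq pK1.
  rewrite ancestorE ?e // in Ap; have op : odd (lev p) by rewrite e /= evenK.
  have [q cq] := child_ex p; have Aq := avoidI_II Ap op cq.
  have aq : ancestor K.+1 q = p by rewrite (child_ancestor cq) ?e // ancestorE ?e.
  (* Outside [loseII U] the answer [None] is tenable. Inside, [force_reach] supplies a target point
     to name, and [avoidI_target] puts it outside [U]. *)
  have [Fq|nFq] := pselect (loseII U q); last first.
    exists q, U, None; rewrite h2 //; split=> //; split=> //.
    - by rewrite cq.2 => /ltn_trans/(_ Kp); rewrite ltnn.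
    - by rewrite aq.
    - by move=> _ m; rewrite cq.2 e -eqn_leq => /eqP<-; rewrite ancestorE ?cq.2 ?e.
  have [u [Au tu lu au]] := force_reach Fq.
  exists q, U, (Some u); rewrite h2 //; split=> //; split=> //.
  - by rewrite cq.2 => /ltn_trans/(_ Kp); rewrite ltnn.
  - by rewrite cq.2 e ltnn.
  - by rewrite aq.
  - move=> _; split=> //; first exact: avoidI_target.
    split=> // ul; have {ul}e' : lev u = lev q by apply/eqP; rewrite eqn_leq ul.
    by rewrite e' ancestorE // -[LHS]au ancestorE // e'.
have {}h4 := h4 K1p; case: o h h2 h4 => [u|] h h2 h4.
  case: h4 => tu nUu cu.
  have [q [cq cqu]] : exists q, child q p /\ comparable q u.
    have [pu|up] := ltnP (lev p) (lev u).
      exists (ancestor (lev p).+1 u); have e := lev_ancestor pu.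
      split; last by split=> [_|]; rewrite e // => ul;
        rewrite ancestor_ancestor // ?[lev u]eqn_leq //; rewrite ancestorE.
      by split=> //; rewrite par_ancestor // cu.1 // ltnW.
    have [q cq] := child_ex p; exists q; split=> //; split=> [|_].
      by rewrite cq.2 => pu; move: (leq_trans pu up); rewrite ltnn.
    by rewrite (child_ancestor cq) // cu.2.
  exists q, U, (Some u); split=> //; split=> //; rewrite cq.2.
  - by move=> /ltn_trans/(_ Kp); rewrite ltnn.
  - by move=> /ltn_trans/(_ K1p); rewrite ltnn.
  - by rewrite (child_ancestor cq).
have [|Ap' nFp] := h4 (lev p); first by rewrite K1p leqnn.
rewrite ancestorE // in Ap' nFp.
have [q [cq Aq nFq]] : exists q, [/\ child q p, avoidI U q & ~ loseII U q].
  have [op|ep] := boolP (odd (lev p)).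
    have [|q cq nq] := nforce_other Ap' nFp; first by rewrite op.
    by exists q; split=> //; exact: avoidI_II Ap' op cq.
  have [||q cq nq] := nforce_other _ Ap'; rewrite ?(negbTE ep) //.
  by exists q; split=> //; exact: nforce_own Ap' nFp (negbTE ep) cq.
exists q, U, None; split=> //; split=> //; rewrite cq.2.
- by move=> /ltn_trans/(_ Kp); rewrite ltnn.
- by rewrite (child_ancestor cq).
- move=> _ m /andP[m1]; rewrite leq_eqVlt => /orP[/eqP->|m2].
    by rewrite ancestorE ?cq.2.
  by rewrite (child_ancestor cq) //; apply: h4; rewrite m1.
Qed.


Definition closed_game : game :=
  @Game pos' par' lev' root' (lev_root T) lev_eq0'
    (fun t => lev_par (sval t).1.1) child_ex'.
Let T' := closed_game.
Implicit Types (s : T' -> T') (x : nat -> T).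

Let proj (t : T') : T := (sval t).1.1.
Let aux (t : T') : set T := (sval t).1.2.
Let opt (t : T') : option T := (sval t).2.

(** * Images of the strategies of the auxiliary game *)

Definition pulled s U o q : T :=
  if pselect (legal q U o) is left h then proj (s (mk h)) else default_strategy q.

Definition aux_of s q : set T :=
  if pselect (legal q set0 None) is left h then aux (s (mk h)) else set0.

Definition answers s q1 : set T :=
  [set u | exists U (h : legal q1 U None), opt (s (mk h)) = Some u].

Definition some_set (P : set (set T)) : set T :=
  if pselect (exists U, P U) is left h then sval (cid h) else set0.

Definition asked s q1 u : set T :=
  some_set [set U | exists h : legal q1 U None, opt (s (mk h)) = Some u].

Definition winning_strategy b R V (a : T) : T -> T :=
  if pselect (force b R V a) is left h then sval (cid (force_strategy h)) else @default_strategy T.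

(* As long as the target cannot be forced, play as if the opponent had promised
   to avoid it; otherwise force it, and continue as if the opponent had named
   the point at which it was reached. *)
Definition transferI s : T -> T :=
  switch K.+1 setT (pulled s set0 None) (fun q1 =>
    let U := aux_of s (par q1) in
    switch K.+2 (loseII U) (pulled s U None) (fun a =>
    switch K.+2 target (winning_strategy false (avoidI U) target a) (fun u => pulled s U (Some u)))).

(* Player [true] pretends that the promised set is the set [U] of all points that
   [s] could be led to name. Unless [U] can be forced, [s] cannot name a point in
   reply to [U], since that point would lie in [U]. *)
Definition transferII s : T -> T :=
  switch K.+1 setT (pulled s set0 None) (fun q1 =>
    let U := answers s q1 in
    let V := [set p | U p /\ K.+1 < lev p] in
    switch K.+1 (force true setT V) (pulled s U None) (fun a =>
    switch K.+2 U (winning_strategy true setT V a) (fun u => pulled s (asked s q1 u) (Some u)))).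

Definition transfer (b : bool) s : T -> T := if b then transferII s else transferI s.

Lemma winning_strategy_valid b R V a : valid (winning_strategy b R V a).
Proof.
rewrite /winning_strategy; case: pselect => [h|_]; last exact: default_strategyP.
by case: (cid _) => ? [].
Qed.

Lemma winning_strategyP b R V a : force b R V a -> wins_from b R V a (winning_strategy b R V a).
Proof. by rewrite /winning_strategy; case: pselect => // h _; case: (cid _) => ? []. Qed.

Lemma pulledE s p U o (h : legal p U o) : pulled s U o p = proj (s (mk h)).
Proof. by rewrite /pulled; case: pselect => // h'; rewrite (Prop_irrelevance h h'). Qed.

Lemma aux_ofE s p (h : legal p set0 None) : aux_of s p = aux (s (mk h)).
Proof. by rewrite /aux_of; case: pselect => // h'; rewrite (Prop_irrelevance h h'). Qed.

Lemma pulled_valid s U o : valid s -> valid (pulled s U o).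
Proof.
move=> vs q; rewrite /pulled; case: pselect => [h|_]; last exact: default_strategyP.
have [e1 e2] := vs (mk h); split=> //.
exact: (congr1 (fun t : pos' => (sval t).1.1) e1).
Qed.

Lemma transfer_valid b s : valid s -> valid (transfer b s).
Proof.
by move=> vs; case: b; rewrite /transfer /transferII /transferI /=; do 3?
 (apply: switch_valid => [|?]; try exact: pulled_valid; try exact: winning_strategy_valid).
Qed.

Lemma pulled_loc s s' n U o p : (forall t : T', lev t <= n -> s t = s' t) ->
  lev p <= n -> pulled s U o p = pulled s' U o p.
Proof. by move=> e ln; rewrite /pulled; case: pselect => // h; rewrite e. Qed.

Lemma transfer_loc b s s' n : (forall t : T', lev t <= n -> s t = s' t) ->
  forall p, lev p <= n -> transfer b s p = transfer b s' p.
Proof.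
move=> e p ln; have te U o := pulled_loc U o e ln.
case: b; rewrite /transfer /transferII /transferI /=; apply: eq_switch => // a la.
- have ea U (h : legal a U None) : s (mk h) = s' (mk h) by rewrite e //= (leq_trans la).
  have -> : answers s a = answers s' a.
    by apply/seteqP; split=> u [U [h E]]; exists U, h; rewrite -E ea.
  apply: eq_switch => // a' la'; apply: eq_switch => // u lu.
  suff -> : asked s a u = asked s' a u by [].
  rewrite /asked; congr some_set.
  by apply/seteqP; split=> U [h E]; exists h; rewrite -E ea.
- have ha : lev (par a) <= n by rewrite lev_par (leq_trans (leq_pred _)) // (leq_trans la).
  have -> : aux_of s (par a) = aux_of s' (par a).
    by rewrite /aux_of; case: pselect => // h; rewrite e.
  by apply: eq_switch => // a' la'; apply: eq_switch.
Qed.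

Lemma transfer_low b s (t : T') : valid s -> lev t < K -> transfer b s (proj t) = proj (s t).
Proof.
move=> vs lt; have -> : transfer b s (proj t) = pulled s set0 None (proj t).
  by case: b; rewrite /transfer /transferII /transferI switch_low // ltnS; exact: ltnW.
case: t lt => [[[p U] o] h] /= lt; have [h1 h2 _ _] := h.
rewrite /= in h1 h2 lt; move: (h); rewrite (h1 (ltnW lt)) (h2 (leqW (ltnW lt))) => h'.
by rewrite /proj /= (pulledE s h').
Qed.

(** Promises are fixed once made, so a lift is given by a single pair [U], [o]. The last two
    hypotheses concern the moves at levels [K] and [K.+1], where [s] itself chooses them. *)
Lemma lift_of b s x U o : valid s -> is_play x ->
  (forall n, legal (x n) (if n <= K then set0 else U) (if n <= K.+1 then None else o)) ->
  (forall n, odd n = b -> x n.+1 =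
     pulled s (if n <= K then set0 else U) (if n <= K.+1 then None else o) (x n)) ->
  (b = false -> aux_of s (x K) = U) ->
  (b = true -> forall h : legal (x K.+1) U None, opt (s (mk h)) = o) ->
  exists x' : nat -> T', [/\ is_play x', follows b s 0 x' & forall n, proj (x' n) = x n].
Proof.
move=> vs px H F A O; pose x' n : T' := mk (H n); exists x'; split=> //.
  split; first by apply: lev_eq0'; rewrite /lev' /= play_lev.
  move=> n; split; last by rewrite /= /lev' /= !play_lev.
  apply: sval_inj' => /=; rewrite (px.2 n).1 (px.2 n).2 play_lev // !ltnS.
  congr (_, _, _); have [//|h] := leqP n _; by rewrite ifF // leqNgt ltnW.
move=> n _ on; set t := s (x' n); have [et lt] := vs (x' n).
have e2 := congr1 aux et; have e3 := congr1 opt et.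
rewrite -/t /aux /opt /= in e2 e3; rewrite /= /lev' /= play_lev // in lt.
rewrite -/t in lt; rewrite lt !ltnS in e2 e3; have [h1 h2 _ _] := svalP t.
apply: sval_inj'; rewrite /= [RHS]surjective_pairing [in RHS](surjective_pairing (sval t).1).
rewrite /= lt in h1 h2; congr (_, _, _).
- by rewrite F // (pulledE s (H n)).
- have [nK|Kn] := leqP n.+1 K; first by rewrite h1.
  move: e2; have [nK|Kn'] := leqP n K; last by [].
  have {nK Kn}eK : n = K by apply/eqP; rewrite eqn_leq nK.
  subst n => _; rewrite -A; last by rewrite -on; exact/negbTE.
  have h : legal (x K) set0 None by have := H K; rewrite leqnn leqnSn.
  rewrite (aux_ofE s h) /t; congr (aux (s _)); apply: sval_inj'.
  by rewrite /= leqnn leqnSn.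
- have [nK|Kn] := leqP n.+1 K.+1; first by rewrite h2.
  move: e3; have [nK|Kn'] := leqP n K.+1; last by [].
  have {nK Kn}eK : n = K.+1 by apply/eqP; rewrite eqn_leq nK.
  subst n => _; have h : legal (x K.+1) U None by have := H K.+1; rewrite leqnn ltnn.
  rewrite -(O _ h); last by rewrite -on /= evenK.
  by rewrite /t; congr (opt (s _)); apply: sval_inj'; rewrite /= leqnn ltnn.
Qed.

Lemma lev_step s p U o (h : legal p U o) : valid s -> lev (proj (s (mk h))) = (lev p).+1.
Proof. by move=> vs; have [] := vs (mk h). Qed.

Lemma aux_step s p U o (h : legal p U o) : valid s -> K < lev p -> aux (s (mk h)) = U.
Proof.
move=> vs Kp; have [et _] := vs (mk h); have := congr1 aux et.
by rewrite /aux /= -/(proj _) lev_step // ltnS leqNgt Kp.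
Qed.

Lemma opt_step s p U o (h : legal p U o) : valid s -> K.+1 < lev p -> opt (s (mk h)) = o.
Proof.
move=> vs Kp; have [et _] := vs (mk h); have := congr1 opt et.
by rewrite /opt /= -/(proj _) lev_step // ltnS leqNgt Kp.
Qed.

Lemma some_step s p U o (h : legal p U o) u : valid s -> K < lev p ->
  opt (s (mk h)) = Some u ->
  [/\ target u, ~ U u & lev p < lev u -> proj (s (mk h)) = ancestor (lev p).+1 u].
Proof.
move=> vs Kp ou; have [_ _ _] := svalP (s (mk h)).
rewrite -/(proj _) -/(aux _) -/(opt _) lev_step // aux_step // ou ltnS Kp.
by case=> // tu nU [cu _]; split=> // pu; rewrite -cu lev_step.
Qed.

Lemma none_step s p U o (h : legal p U o) : valid s -> K < lev p ->
  opt (s (mk h)) = None ->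
  avoidI U (proj (s (mk h))) /\ ~ loseII U (proj (s (mk h))).
Proof.
move=> vs Kp ou; have [_ _ _] := svalP (s (mk h)).
rewrite -/(proj _) -/(aux _) -/(opt _) lev_step // aux_step // ou ltnS Kp.
by move=> /(_ isT (lev p).+1); rewrite ltnS Kp leqnn ancestorE ?lev_step //; apply.
Qed.

(** Between levels [K.+2] and [lev u] the play need not have been dictated by [s]: once [u] is
    named, comparability leaves a single legal move, so [s] has to follow the play up to [u]. *)
Lemma lift_hit b s x U u : valid s -> is_play x -> legal (x K.+1) U None ->
  target u -> ~ U u -> u = x (lev u) ->
  (forall n, n <= K -> odd n = b -> x n.+1 = pulled s set0 None (x n)) ->
  (b = false -> aux_of s (x K) = U) ->
  (b = true -> x K.+2 = pulled s U None (x K.+1) /\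
     forall h : legal (x K.+1) U None, opt (s (mk h)) = Some u) ->
  (forall n, lev u <= n -> odd n = b -> x n.+1 = pulled s U (Some u) (x n)) ->
  exists x' : nat -> T', [/\ is_play x', follows b s 0 x' & forall n, proj (x' n) = x n].
Proof.
move=> vs px lU tu nU xu H0 A O H1.
have L n : K.+1 < n -> legal (x n) U (Some u).
  move=> Kn; have [_ _ h3 _] := lU; rewrite play_lev // ancestorE ?play_lev // in h3.
  split; rewrite play_lev //.
  - by move=> h; move: (leq_trans (ltnW Kn) h); rewrite ltnn.
  - by rewrite leqNgt Kn.
  - by rewrite play_ancestor ?(ltnW Kn) // => _; exact: h3.
  - by split=> //; rewrite xu; exact: play_comparable.
apply: (lift_of (U := U) (o := Some u)) => //.
- move=> n; have [nK|Kn] := leqP n K; first by rewrite (leqW nK); apply: legal_low; rewrite play_lev.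
  have [nK1|K1n] := leqP n K.+1; last exact: L.
  by have -> : n = K.+1 by apply/eqP; rewrite eqn_leq nK1.
- move=> n on; have [nK|Kn] := leqP n K; first by rewrite (leqW nK); exact: H0.
  have [nK1|K1n] := leqP n K.+1.
    have e : n = K.+1 by apply/eqP; rewrite eqn_leq nK1.
    by subst n; apply: (O _).1; rewrite -on /= evenK.
  have [un|nu] := leqP (lev u) n; first exact: H1.
  rewrite (pulledE s (L n K1n)).
  have [||_ _ ->] := @some_step s _ _ _ (L n K1n) u vs; rewrite ?play_lev //.
  - by apply: opt_step => //; rewrite play_lev.
  - by rewrite xu play_ancestor.
- by move=> bt; apply: (O bt).2.
Qed.


Lemma follow_low (b : bool) s x : is_play x -> follows b (transfer b s) 0 x ->
  forall n, n <= K -> odd n = b -> x n.+1 = pulled s set0 None (x n).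
Proof.
move=> px fx n nK on; rewrite fx //.
by case: b {fx on}; rewrite /transfer /transferII /transferI switch_low // play_lev.
Qed.

Lemma none_legal n x U : is_play x -> K < n -> avoidI U (x K.+1) ->
  (forall j, K.+1 < j <= n -> avoidI U (x j) /\ ~ loseII U (x j)) ->
  legal (x n) U None.
Proof.
move=> px Kn A H; split; rewrite ?play_lev //.
- by rewrite leqNgt Kn.
- by rewrite play_ancestor.
- by move=> K1n m /andP[h1 h2]; rewrite play_ancestor //; apply: H; rewrite h1.
Qed.

Lemma none_legal_all n x U : is_play x -> avoidI U (x K.+1) ->
  (forall j, K.+1 < j -> avoidI U (x j) /\ ~ loseII U (x j)) ->
  legal (x n) (if n <= K then set0 else U) (if n <= K.+1 then None else None).
Proof.
move=> px A H; rewrite if_same; have [nK|Kn] := leqP n K.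
  by apply: legal_low; rewrite play_lev.
by apply: none_legal => // j /andP[? _]; exact: H.
Qed.

Lemma switch_all N (s0 : T -> T) t x n : is_play x -> N <= n ->
  switch N setT s0 t (x n) = t (x N) (x n).
Proof.
move=> px Nn; rewrite (@switch_hit _ _ _ _ _ _ N) ?leqnn ?Nn // => j /andP[h1 h2].
by move: (leq_ltn_trans h1 h2); rewrite ltnn.
Qed.

Lemma follow_hit b R V n0 a (S : set T) x (t : T -> T -> T) : is_play x -> a = x n0 ->
  force b R V a -> K.+2 <= n0.+1 -> (forall u, V u -> K.+1 < lev u) ->
  (forall j, K.+1 < j < n0 -> ~ V (x j)) ->
  (forall n, n0 <= n -> odd n = b -> x n.+1 = switch K.+2 S (winning_strategy b R V a) t (x n)) ->
  (forall j, K.+1 < j -> (V (x j) <-> S (x j))) ->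
  exists m0, [/\ K.+1 < m0, n0 <= m0, V (x m0), R (x m0) &
    forall n, m0 <= n -> odd n = b -> x n.+1 = t (x m0) (x n)].
Proof.
move=> px ea fa Kn0 HV nV Hx Vs.
have la : lev a = n0 by rewrite ea play_lev.
have [||m [h1 h2 h3]] := @winning_strategyP _ _ _ _ fa x px; first by rewrite la -ea.
  rewrite la => n n0n nVn on; rewrite Hx // switch_miss // => j /andP[Kj jn].
  move/(Vs _ Kj).2; have [jn0|n0j] := ltnP j n0; first by apply: nV; rewrite Kj.
  by apply: nVn; rewrite n0j.
rewrite la in h1 h3; have Km : K.+1 < m by rewrite -(play_lev m px); exact: HV.
have [|m0 [Km0 Vm0 Hm0]] := @first_level _ K.+2 V x; first by exists m.
have n0m0 : n0 <= m0.
  by rewrite leqNgt; apply/negP => lt; apply: (nV m0) => //; rewrite Km0.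
exists m0; split=> //.
  apply: h3; rewrite n0m0 leqNgt; apply/negP => lt.
  by apply: (Hm0 m); rewrite ?Km.
move=> n m0n on; rewrite Hx ?(leq_trans n0m0) // (@switch_hit _ _ _ _ _ _ m0) ?Km0 //.
  exact/(Vs _ Km0).1.
by move=> j jb; have /andP[Kj _] := jb => /(Vs _ Kj).2; exact: Hm0.
Qed.

(** If the play never enters [loseII U], the opponent is deemed to have answered [None]. Otherwise
    the target is forced at a point where [avoidI U] holds; it lies outside [U], so the opponent
    could have named it. *)
Lemma liftI s x : valid s -> is_play x -> follows false (transferI s) 0 x ->
  exists x' : nat -> T', [/\ is_play x', follows false s 0 x' & forall n, proj (x' n) = x n].
Proof.
move=> vs px fx; have H0 := follow_low px (fx : follows false (transfer false s) 0 x).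
pose U := aux_of s (x K).
have h : legal (x K) set0 None by apply: legal_low; rewrite play_lev.
have eU : aux (s (mk h)) = U by rewrite /U (aux_ofE s h).
have xK1 : x K.+1 = proj (s (mk h)) by rewrite H0 ?(pulledE s h) //; exact/negbTE.
have lU : legal (x K.+1) U None.
  rewrite xK1; have := svalP (s (mk h)).
  rewrite /legal_triple -/(proj _) -/(aux _) -/(opt _) eU => l.
  have [_ h2 _ _] := l; have eo : opt (s (mk h)) = None by apply: h2; rewrite -xK1 play_lev.
  by rewrite eo in l.
have AK : avoidI U (x K.+1) by have [_ _ + _] := lU; rewrite play_lev // ancestorE ?play_lev //; apply.
have F1 n : K < n -> odd n = false -> x n.+1 = switch K.+2 (loseII U) (pulled s U None)
    (fun a => switch K.+2 target (winning_strategy false (avoidI U) target a) (fun u => pulled s U (Some u))) (x n).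
  by move=> Kn on; rewrite fx // /transferI switch_all // (px.2 K).1.
have good n : K < n -> (forall j, K.+1 < j <= n -> ~ loseII U (x j)) ->
    avoidI U (x n) /\ forall j, K.+1 < j <= n -> avoidI U (x j) /\ ~ loseII U (x j).
  elim: n => // n IH; rewrite ltnS leq_eqVlt => /orP[/eqP<- _|Kn nL].
    split=> // j /andP[h1 h2]; by move: (leq_trans h1 h2); rewrite ltnn.
  have [|An Hn] := IH Kn; first by move=> j /andP[h1 h2]; apply: nL; rewrite h1 leqW.
  have An1 : avoidI U (x n.+1).
    have [on|en] := boolP (odd n).
      by apply: avoidI_II An _ (px.2 n); rewrite play_lev.
    rewrite F1 ?(negbTE en) // switch_miss //; last first.
      by move=> j /andP[h1 h2]; apply: nL; rewrite h1 leqW.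
    have l : legal (x n) U None by exact: none_legal.
    rewrite (pulledE s l).
    have := @none_step s _ _ _ l vs; rewrite play_lev // => /(_ Kn) [] //.
    apply: opt_step => //; rewrite play_lev //.
    move: Kn; rewrite leq_eqVlt => /orP[/eqP e|//].
    by move: en; rewrite -e /= evenK.
  split=> // j /andP[h1]; rewrite leq_eqVlt => /orP[/eqP->|h2].
    by split=> //; apply: nL; rewrite leqnn ltnS Kn.
  by apply: Hn; rewrite h1.
have [[n1 Kn1 Ln1]|nL] := pselect (exists2 n, K.+1 < n & loseII U (x n)); last first.
  have nL' n : K.+1 < n -> ~ loseII U (x n) by move=> Kn Ln; apply: nL; exists n.
  have G j : K.+1 < j -> avoidI U (x j) /\ ~ loseII U (x j).
    move=> Kj; have [|_] := good j (ltnW Kj); first by move=> i /andP[? _]; exact: nL'.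
    by apply; rewrite Kj leqnn.
  apply: (lift_of (U := U) (o := None)) => //; first by move=> n; exact: none_legal_all.
  move=> n on; rewrite if_same; have [nK|Kn] := leqP n K; first exact: H0.
  by rewrite F1 // switch_miss // => j /andP[? _]; exact: nL'.
have [|n0 [Kn0 Ln0 Hn0]] := @first_level _ K.+2 (loseII U) x; first by exists n1.
have [||||m0 [Km0 n0m0 tm0 Am0 Hm0]] := @follow_hit false (avoidI U) target n0 (x n0) target x
    (fun u => pulled s U (Some u)) px erefl Ln0 (leqW Kn0).
- by move=> u [].
(* No target is met before [n0]: such a point would already lie in [loseII U]. *)
- move=> j /andP[Kj jn]; have [|_ /(_ j)] := good j (ltnW Kj).
    by move=> i /andP[? ij]; apply: Hn0; apply/andP; split=> //; exact: leq_ltn_trans jn.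
  by rewrite Kj leqnn => -[] // Aj nLj tj; apply: nLj; exact: loseII_target.
- move=> n n0n on; rewrite F1 //; last by apply: leq_trans n0n; exact: ltnW.
  by rewrite (@switch_hit _ _ _ _ _ _ n0) ?Kn0.
- by [].
apply: (lift_hit (U := U) (u := x m0)) => //; try by rewrite play_lev.
exact: avoidI_target.
Qed.

(** If [U] is hit at [u], then [u] is the answer of [s] to some promise, and the play is lifted as
    if that promise had been made: the moves of player [true] below level [K.+1] do not depend on
    it, and the one at [K.+1] heads for [u]. *)
Lemma liftII s x : valid s -> is_play x -> follows true (transferII s) 0 x ->
  exists x' : nat -> T', [/\ is_play x', follows true s 0 x' & forall n, proj (x' n) = x n].
Proof.
move=> vs px fx; have H0 := follow_low px (fx : follows true (transfer true s) 0 x).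
pose U := answers s (x K.+1); pose V := [set p | U p /\ K.+1 < lev p].
have oK1 : odd K.+1 by rewrite /= evenK.
have F1 n : K < n -> odd n = true -> x n.+1 = switch K.+1 (force true setT V) (pulled s U None)
    (fun a => switch K.+2 U (winning_strategy true setT V a)
       (fun u => pulled s (asked s (x K.+1) u) (Some u))) (x n).
  by move=> Kn on; rewrite fx // /transferII switch_all.
have [[n1 Kn1 Ln1]|nL] := pselect (exists2 n, K < n & force true setT V (x n)); last first.
  have A n : K < n -> avoidI U (x n) by move=> Kn Ln; apply: nL; exists n.
  have F2 n : K < n -> odd n = true -> x n.+1 = pulled s U None (x n).
    by move=> Kn on; rewrite F1 // switch_miss // => j /andP[? _]; exact: A.
  have lU : legal (x K.+1) U None.
    apply: none_legal => //; first exact: A.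
    by move=> j /andP[h1 h2]; move: (leq_trans h1 h2); rewrite ltnn.
  have nS (h : legal (x K.+1) U None) : opt (s (mk h)) = None.
    case e : (opt _) => [u|//].
    have [|_ nUu _] := some_step vs _ e; first by rewrite play_lev.
    by case: nUu; exists U, h.
  have G n : K.+1 < n -> (forall j, K.+1 < j <= n -> avoidI U (x j) /\ ~ loseII U (x j)).
    elim: n => // n IH Kn j /andP[Kj]; rewrite leq_eqVlt => /orP[/eqP->{j Kj}|jn]; last first.
      by apply: IH; rewrite ?Kj //; exact: leq_trans Kj _.
    split; first exact/A/ltnW.
    move: Kn; rewrite ltnS leq_eqVlt => /orP[/eqP e|Kn].
      rewrite -e F2 // (pulledE s lU).
      by have [||_ ] := @none_step s _ _ _ lU vs; rewrite ?play_lev.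
    have l : legal (x n) U None by apply: none_legal; [| exact: ltnW | exact: A | exact: IH].
    have [on|en] := boolP (odd n).
      rewrite F2 ?(ltnW Kn) // (pulledE s l).
      have [||_ ] := @none_step s _ _ _ l vs; rewrite ?play_lev ?(ltnW Kn) //.
      by apply: opt_step => //; rewrite play_lev.
    have [|An nLn] := IH Kn n; first by rewrite Kn leqnn.
    apply: (nforce_own An nLn _ (px.2 n)); rewrite play_lev //; exact/negbTE.
  have G' j : K.+1 < j -> avoidI U (x j) /\ ~ loseII U (x j).
    by move=> Kj; apply: (G j) => //; rewrite Kj leqnn.
  apply: (lift_of (U := U) (o := None)) => //.
  - by move=> n; apply: none_legal_all => //; exact: A.
  - by move=> n on; rewrite if_same; have [nK|Kn] := leqP n K; [exact: H0 | exact: F2].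
have [|n0 [Kn0 Ln0 Hn0]] := @first_level _ K.+1 (force true setT V) x; first by exists n1.
have [||||m0 [Km0 n0m0 [Um0 _] _ Hm0]] := @follow_hit true setT V n0 (x n0) U x
    (fun u => pulled s (asked s (x K.+1) u) (Some u)) px erefl Ln0 Kn0.
- by move=> u [].
- move=> j /andP[Kj jn] Vj; apply: (Hn0 j); rewrite ?jn ?(ltnW Kj) //.
  exact: ForceHit.
- move=> n n0n on; rewrite F1 //; last exact: leq_trans n0n.
  by rewrite (@switch_hit _ _ _ _ _ _ n0) ?Kn0.
- by move=> j Kj; split=> [[]//|Uj]; split=> //; rewrite play_lev.
set u := x m0 in Um0 Hm0; pose U' := asked s (x K.+1) u.
have [lU os] : exists lU : legal (x K.+1) U' None, opt (s (mk lU)) = Some u.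
  rewrite /U' /asked /some_set; case: pselect => [h|]; first by case: (cid h).
  by case: Um0 => U1 ?; case; exists U1.
have [|tu nUu nxt] := some_step vs _ os; first by rewrite play_lev.
have xu : u = x (lev u) by rewrite play_lev.
apply: (lift_hit (U := U') (u := u)) => //.
- move=> _; split; last by move=> h; rewrite (Prop_irrelevance h lU).
  rewrite (pulledE s lU) nxt !play_lev //; by rewrite play_ancestor.
- by rewrite play_lev.
Qed.

Definition closed_cov : covering K closed_game T.
Proof.
apply: (@Covering K closed_game T proj _ _ _ _ transfer transfer_valid transfer_loc transfer_low) => //.
- move=> t t'; case: t t' => [[[p U] o] h] [[[p' U'] o'] h'] /= lp ep.
  apply: sval_inj' => /=; move: (h) (h') => [/= h1 h2 _ _] [/= h1' h2' _ _].
  rewrite /proj /= in ep; rewrite -ep in h1' h2'.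
  by rewrite ep h1 ?h2 ?h1' ?h2' // ltnW // ltnS.
- move=> q lq; have h : legal q set0 None by exact: legal_low.
  by exists (mk h).
- by case=> s x vs px fx; [exact: liftII | exact: liftI].
Defined.

(** Membership is settled at level [K.+2]: a named point lies in [W], and after [None] the play
    never meets the target, since a target point satisfying [avoidI U] is in [loseII U]. *)
Lemma closed_cov_clopen (A : set (nat -> T)) : open_set A ->
  W = [set p | forall x, is_play x -> x (lev p) = p -> A x] ->
  clopen_set [set x' | A (cov_map closed_cov \o x')].
Proof.
move=> oA eW.
have optE (x' : nat -> T') : is_play x' -> forall n, K.+1 < n -> opt (x' n) = opt (x' K.+2).
  move=> px'; elim=> // n IH; rewrite ltnS leq_eqVlt => /orP[/eqP<-//|Kn].
  rewrite -IH //; have e1 : lev (proj (x' n.+1)) = n.+1 := play_lev n.+1 px'.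
  have <- : (if lev (proj (x' n.+1)) <= K.+2 then None else opt (x' n.+1)) = opt (x' n).
    exact: (congr1 opt (px'.2 n).1).
  by rewrite e1 ltnS leqNgt Kn.
have ADE (x' : nat -> T') : is_play x' -> A (proj \o x') <-> exists u, opt (x' K.+2) = Some u.
  move=> px'; have px : is_play (proj \o x') := game_map_play (cov_game_map closed_cov) px'.
  have lg n : K.+1 < n -> [/\ lev (proj (x' n)) = n, legal (proj (x' n)) (aux (x' n)) (opt (x' K.+2))
      & opt (x' n) = opt (x' K.+2)].
    move=> Kn; split; [exact: play_lev n px' | | exact: optE].
    by rewrite -(optE _ px' n Kn); exact: svalP (x' n).
  split=> [Ax|[u eu]]; last first.
    have [h1 [_ _ _ h4] _] := lg _ (leq_maxl K.+2 (lev u)).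
    move: h4; rewrite h1 leq_maxl eu => /(_ isT) [tu _ [_ cu]].
    have : W u by case: tu.
    rewrite eW; apply=> //; move: cu; rewrite h1 leq_maxr => /(_ isT) cu.
    by rewrite -[RHS]cu; apply: esym; apply: (play_ancestor px); rewrite leq_maxr.
  case e : (opt _) => [u|]; first by exists u.
  have [n Hn] := oA _ px Ax; pose m := maxn K.+2 n.
  have Km : K.+1 < m by rewrite leq_maxl.
  have [h1 [_ _ _ h4] _] := lg _ Km.
  move: h4; rewrite h1 e => /(_ Km m); rewrite Km leqnn ancestorE ?h1 // => /(_ isT) [h5 []].
  apply: loseII_target => //; split; last by rewrite h1.
  rewrite eW => y py; rewrite h1 => ey; apply: Hn => //.
  have nm : n <= m by rewrite leq_maxr.
  by rewrite -(play_ancestor py nm) ey; exact: (play_ancestor px nm).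
split=> x' px'; rewrite /= => H; exists K.+2 => y' py' ey /=.
  by apply/(ADE _ py'); rewrite ey; exact/(ADE _ px').
by move/(ADE _ py'); rewrite ey => /(ADE _ px').
Qed.

End ClosedUnraveling.

(** * Inverse limits and Borel determinacy *)

Definition thread (T : nat -> game) kk (c : forall i, covering (kk i) (T i.+1) (T i))
  (f : forall i, T i) := forall i, cov_map (c i) (f i.+1) = f i.

Lemma thread_lev T kk (c : forall i, covering (kk i) (T i.+1) (T i)) f i j :
  thread c f -> lev (f i) = lev (f j).
Proof.
move=> tf; have h n : lev (f n) = lev (f 0).
  by elim: n => // n IH; rewrite -IH -(tf n) cov_map_lev.
by rewrite !h.
Qed.

(** Coordinates above [i] are chosen by surjectivity at low levels, those below are images. The
    induction on [i] drops the first game of the sequence. *)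
Lemma thread_ex T kk (c : forall i, covering (kk i) (T i.+1) (T i)) i (q : T i) :
  (forall j, kk j <= kk j.+1) -> lev q <= kk i -> exists2 f, thread c f & f i = q.
Proof.
elim: i T kk c q => [|i IH] T kk c q kS lq; last first.
  have [f tf fi] := IH (T \o S) (kk \o S) (fun j => c j.+1) q (fun j => kS j.+1) lq.
  exists (fun j => if j is j'.+1 return T j then f j' else cov_map (c 0) (f 0)) => //.
  by case=> [|j] //=; exact: tf.
have up j (p : T j) : {p' : T j.+1 | lev p <= kk j -> cov_map (c j) p' = p}.
  apply: cid; have [lp|_] := leqP (lev p) (kk j); last by exists (root _).
  by have [p' e] := cov_map_surj (c j) lp; exists p'.
pose f := nat_rect T q (fun j p => sval (up j p)).
have Hf j : lev (f j) = lev q /\ cov_map (c j) (f j.+1) = f j.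
  have E i : lev (f i) = lev q -> cov_map (c i) (f i.+1) = f i.
    move=> e; rewrite /f /=; case: (up _ _) => p' /=; apply; rewrite -/(f i) e.
    by elim: (i) => // n IH; apply: leq_trans IH (kS n).
  have L : lev (f j) = lev q by elim: j => // j IH; rewrite -IH -(E j IH) cov_map_lev.
  by split=> //; exact: E.
by exists f => // j; exact: (Hf j).2.
Qed.

Lemma thread_uniq T kk (c : forall i, covering (kk i) (T i.+1) (T i)) f g i :
  (forall j, kk j <= kk j.+1) -> thread c f -> thread c g ->
  lev (f i) <= kk i -> f i = g i -> f = g.
Proof.
move=> kS tf tg li e; apply: functional_extensionality_dep => j.
have [ij|/ltnW ji] := leqP i j; last first.
  rewrite -(subnK ji) in e; elim: (i - j) e => // d IH e; apply: IH.
  by rewrite -tf -tg e.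
rewrite -(subnK ij); elim: (j - i) => [//|d IH] /=.
have kd : kk i <= kk (d + i) by elim: d {IH} => // d IH; apply: leq_trans IH (kS _).
apply: (cov_map_inj (c := c (d + i))); last by rewrite tf tg.
by apply: leq_trans kd; rewrite -[lev _](thread_lev i _ tf).
Qed.

Section Limit.
Variables (T : nat -> game) (kk : nat -> nat).
Variable c : forall i, covering (kk i) (T i.+1) (T i).
Hypothesis kS : forall i, kk i <= kk i.+1.
Hypothesis ki : forall i, i <= kk i.

Let lpos := {f | thread c f}.
Implicit Types f g : lpos.

Let lpos_eq f g i : lev (sval f i) <= kk i -> sval f i = sval g i -> f = g.
Proof.
case: f g => [f tf] [g tg] /= l e; have := thread_uniq kS tf tg l e.
by move=> efg; case: _ / efg tg => tg; rewrite (Prop_irrelevance tf tg).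
Qed.

Let lroot : lpos.
Proof.
exists (fun i => root (T i)) => i; apply: lev_eq0; rewrite cov_map_lev; exact: lev_root.
Defined.

Let lpar f : lpos.
Proof. by exists (fun i => par (sval f i)) => i; rewrite cov_map_par (svalP f). Defined.

Let llev f := lev (sval f 0).

Let llevE f i : lev (sval f i) = llev f. Proof. exact: thread_lev (svalP f). Qed.

Let llev_eq0 f : llev f = 0 -> f = lroot.
Proof. by move=> h; apply: (lpos_eq (i := 0)); [rewrite [lev _]h | exact: lev_eq0]. Qed.

Let lev_le_kk n i : n <= i -> n <= kk i. Proof. by move=> h; exact: leq_trans h (ki i). Qed.

Let lchild f : exists g, lpar g = f /\ llev g = (llev f).+1.
Proof.
set i := (llev f).+1; have [q [pq lq]] := child_ex (sval f i).
rewrite llevE in lq; have [|g tg gi] := @thread_ex _ _ c i q kS.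
  by rewrite lq lev_le_kk.
exists (exist _ g tg); have lg : lev (g i) = (llev f).+1 by rewrite gi.
split; last by apply: etrans lg; exact: (thread_lev 0 i tg).
by apply: (lpos_eq (i := i)); rewrite /= ?gi ?pq // llevE lev_le_kk // leqnSn.
Qed.

Definition limit_game : game :=
  @Game lpos lpar llev lroot (lev_root _) llev_eq0 (fun f => lev_par _) lchild.
Let L := limit_game.
Implicit Types (s : L -> L).

Definition limit_proj i : game_map L (T i).
Proof. by exists (fun f : L => sval f i) => f //; exact: llevE. Defined.

(** The thread through [q] is unique up to level [kk i]; beyond it the choice is arbitrary. *)
Definition limit_local_strategy s i (q : T i) : T i :=
  if pselect (exists f : L, sval f i = q) is left h
  then sval (s (sval (cid h))) i else default_strategy q.

Lemma limit_local_strategy_valid s i : valid s -> valid (limit_local_strategy s (i := i)).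
Proof.
move=> vs q; rewrite /limit_local_strategy; case: pselect => [h|_]; last exact: default_strategyP.
case: (cid h) => f /= <-; have [e l] := vs f; split; last by rewrite !llevE.
exact: (congr1 (fun g : lpos => sval g i) e).
Qed.

Lemma limit_local_strategyE s i f : llev f <= kk i -> limit_local_strategy s (sval f i) = sval (s f) i.
Proof.
move=> l; rewrite /limit_local_strategy; case: pselect => [h|[]]; last by exists f.
by case: (cid h) => g /= e; congr (sval (s _) i); apply: (lpos_eq (i := i)) => //; rewrite llevE -(llevE g i) e llevE.
Qed.

Fixpoint push b s d j : T j -> T j :=
  if d is d'.+1 then cov_strategy (c j) b (push b s d' (j := j.+1)) else limit_local_strategy s (i := j).

Lemma push_valid b s d j : valid s -> valid (push b s d (j := j)).
Proof.
by move=> vs; elim: d j => [|d IH] j; [exact: limit_local_strategy_valid | exact: cov_strategy_valid].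
Qed.

Lemma push_loc b s s' n : (forall f, llev f <= n -> s f = s' f) ->
  forall d j (p : T j), lev p <= n -> push b s d p = push b s' d p.
Proof.
move=> e; elim=> [|d IH] j p lp /=; last exact: cov_strategy_loc (IH _) _ lp.
rewrite /limit_local_strategy; case: pselect => // h; case: (cid h) => f /= ef; rewrite e //.
by rewrite -(llevE f j) ef.
Qed.

Lemma push_step b s d j (p : T j) : valid s -> lev p < kk (d + j) ->
  push b s d.+1 p = push b s d p.
Proof.
move=> vs; elim: d j p => [|d IH] j p lp; last first.
  apply: (@cov_strategy_loc _ _ _ (c j) b _ _ (lev p)) => // p' lp'; apply: IH.
  by rewrite addnS; exact: leq_ltn_trans lp' lp.
have [f tf fj] := thread_ex c kS (ltnW lp : lev p <= kk j).
have [g gj] : exists g : L, sval g j = p by exists (exist _ f tf).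
have lg : llev g = lev p by rewrite -(llevE g j) gj.
have <- : cov_map (c j) (sval g j.+1) = p by rewrite -gj; exact: (svalP g j).
rewrite /= cov_strategy_low //; last 2 first.
- exact: limit_local_strategy_valid.
- by rewrite llevE lg.
rewrite (svalP g) !limit_local_strategyE ?lg ?(ltnW lp) //; first exact: (svalP (s g)).
by apply: leq_trans (kS j); exact: ltnW.
Qed.

Lemma push_stable b s d j (p : T j) : valid s -> lev p < d -> push b s d p = push b s (lev p).+1 p.
Proof.
move=> vs ld; rewrite -(subnK ld); elim: (d - _) => // e IH.
by rewrite addSn push_step // lev_le_kk // -addnA addnCA leq_addr.
Qed.

(** A limit over [d]: by [push_stable] every [d] above [lev p] gives the same value, because
    [i <= kk i]. *)
Definition limit_strategy b s j (p : T j) : T j := push b s (lev p).+1 p.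

Lemma limit_strategy_valid b s j : valid s -> valid (limit_strategy b s (j := j)).
Proof. by move=> vs p; exact: push_valid. Qed.

Lemma limit_strategy_cov b s j p : valid s -> cov_strategy (c j) b (limit_strategy b s (j := j.+1)) p = limit_strategy b s p.
Proof.
move=> vs; have -> : limit_strategy b s p = push b s (lev p).+2 p.
  exact: (esym (@push_stable b s (lev p).+2 j p vs (leqnSn _))).
apply: (@cov_strategy_loc _ _ _ (c j) b _ _ (lev p)) => // p' lp'.
exact: (esym (@push_stable b s (lev p).+1 j.+1 p' vs lp')).
Qed.

Lemma limit_strategy_local b s j p : valid s -> lev p < kk j -> limit_strategy b s p = limit_local_strategy s p :> T j.
Proof.
move=> vs lp; rewrite /limit_strategy; elim: (lev p).+1 => // d <-; apply: push_step => //.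
by elim: d => // d IH; apply: leq_trans IH (kS _).
Qed.

Lemma limit_lift b s (x : nat -> T 0) : valid s -> is_play x -> follows b (limit_strategy b s (j := 0)) 0 x ->
  exists x', [/\ is_play x', follows b s 0 x' & forall n, limit_proj 0 (x' n) = x n].
Proof.
move=> vs px fx.
pose ok j (y : nat -> T j) := is_play y /\ follows b (limit_strategy b s (j := j)) 0 y.
have up j (y : nat -> T j) :
    {y' : nat -> T j.+1 | ok j y -> ok j.+1 y' /\ forall n, cov_map (c j) (y' n) = y n}.
  apply: cid; have [[py fy]|no] := pselect (ok j y); last first.
    by exists (fun=> root _) => h.
  have [|y' [h1 h2 h3]] := @cov_strategy_lift _ _ _ (c j) b _ y (limit_strategy_valid b vs) py.
    by move=> n h on; rewrite limit_strategy_cov // fy.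
  by exists y'.
pose y := nat_rect (fun j => nat -> T j) x (fun j y => sval (up j y)).
have oky j : ok j (y j).
  elim: j => [//|j IH]; rewrite /y /=; case: (up _ _) => y' H.
  by case: (H IH).
have tn n : thread c (fun j => y j n).
  by move=> j; rewrite /y /=; case: (up _ _) => y' /= H; case: (H (oky j)) => _; apply.
pose x' n : L := exist _ (fun j => y j n) (tn n).
have lx' n : llev (x' n) = n by rewrite /llev /= play_lev.
exists x'; split=> //.
  split; first by apply: llev_eq0; exact: lx'.
  move=> n; split; last by rewrite /= !lx'.
  apply: (lpos_eq (i := n)); first by rewrite llevE [llev _](_ : _ = n) ?ki // /llev /= lev_par play_lev.
  by have [[_ h] _] := oky n; exact: (h n).1.
(* Coordinate [n.+1] is the one to look at: both [n] and [n.+1] are levels up to [kk n.+1], the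
   first strictly below. *)
move=> n _ on; have [[px1 pc] fy] := oky n.+1.
apply: (lpos_eq (i := n.+1)); first by rewrite llevE lx' ki.
have E : y n.+1 n.+1 = limit_local_strategy s (y n.+1 n).
  by rewrite fy // limit_strategy_local // play_lev // ki.
apply: etrans E _; apply: (limit_local_strategyE s (i := n.+1) (f := x' n)).
by rewrite lx' lev_le_kk.
Qed.

Definition limit_cov : covering (kk 0) L (T 0).
Proof.
apply: (@Covering (kk 0) L (T 0) (limit_proj 0) _ _ _ _ (fun b s => limit_strategy b s (j := 0))) => //.
- by move=> p q lp e; exact: (lpos_eq lp e).
- by move=> q lq; have [f tf f0] := @thread_ex _ _ c 0 q kS lq; exists (exist _ f tf).
- by move=> b s vs; exact: limit_strategy_valid.
- by move=> b s s' n e p lp; exact: (push_loc b e (lev p).+1 lp).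
- by move=> b s p vs lp; rewrite limit_strategy_local // limit_local_strategyE // ltnW.
- by move=> b s x; exact: limit_lift.
Defined.

End Limit.

(** * Operations on coverings and the induction on Borel sets *)

Definition cov_comp k (T1 T2 T3 : game) (c : covering k T1 T2) (c' : covering k T2 T3) : covering k T1 T3.
Proof.
apply: (@Covering k T1 T3 (cov_map c' \o cov_map c) _ _ _ _ (fun b => cov_strategy c' b \o cov_strategy c b)) => /=.
- by move=> p; rewrite !cov_map_lev.
- by move=> p; rewrite !cov_map_par.
- move=> p q lp /cov_map_inj e; apply: (cov_map_inj (c := c)) => //; apply: e; by rewrite cov_map_lev.
- move=> q lq; have [q' e] := cov_map_surj c' lq.
  have [|p e'] := @cov_map_surj _ _ _ c q'; first by rewrite -(cov_map_lev c') e.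
  by exists p; rewrite e'.
- by move=> b s vs; apply: cov_strategy_valid; exact: cov_strategy_valid.
- by move=> b s s' n e p; apply: cov_strategy_loc => p'; exact: cov_strategy_loc.
- by move=> b s p vs lp; rewrite !cov_strategy_low ?cov_map_lev //; exact: cov_strategy_valid.
- move=> b s x vs px fx; have [y [py fy ey]] := @cov_strategy_lift _ _ _ c' b _ x (cov_strategy_valid c b vs) px fx.
  have [z [pz fz ez]] := @cov_strategy_lift _ _ _ c b _ y vs py fy.
  by exists z; split=> // n /=; rewrite ez.
Defined.

Definition cov_le k K (T1 T2 : game) (c : covering K T1 T2) (kK : k <= K) : covering k T1 T2.
Proof.
apply: (@Covering k T1 T2 (cov_map c) (cov_map_lev c) (cov_map_par c) _ _ (cov_strategy c)).
- by move=> p q lp; apply: cov_map_inj; exact: leq_trans kK.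
- by move=> q lq; apply: cov_map_surj; exact: leq_trans kK.
- by move=> b s; exact: cov_strategy_valid.
- by move=> b s s' n e p; exact: cov_strategy_loc.
- by move=> b s p vs lp; apply: cov_strategy_low => //; exact: leq_trans kK.
- by move=> b s x; exact: cov_strategy_lift.
Defined.

Definition game_map_comp (T1 T2 T3 : game) (m' : game_map T2 T3) (m : game_map T1 T2) : game_map T1 T3.
Proof. by exists (m' \o m) => p /=; rewrite ?game_map_lev ?game_map_par. Defined.

Definition game_map_id (G : game) : game_map G G := @GameMap G G id (fun=> erefl) (fun=> erefl).

Lemma clopen_game_map (T' T : game) (m : game_map T' T) (A : set (nat -> T)) :
  clopen_set A -> clopen_set [set x | A (m \o x)].
Proof.
by case=> h1 h2; split=> x px Ax; [have [n H] := h1 _ (game_map_play m px) Ax |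
  have [n H] := h2 _ (game_map_play m px) Ax]; exists n => y py e; apply: H => /=;
  rewrite ?e //; exact: game_map_play.
Qed.

(* The quantification over all games above [T] is what makes the induction on
   Borel sets pass to the successive coverings in a countable union. *)
Definition unravelable (T : game) (A : set (nat -> T)) := forall T' (m : game_map T' T) k,
  exists T'' (c : covering k T'' T'), clopen_set [set x | A (m \o (cov_map c \o x))].

Lemma unravelable_open (T : game) (A : set (nat -> T)) : open_set A -> unravelable A.
Proof.
move=> oA T' m k; pose B := [set x | A (m \o x)].
have oB : open_set B.
  move=> x px Bx; have [n H] := oA _ (game_map_play m px) Bx.
  by exists n => y py e; apply: H; [exact: game_map_play | rewrite /= e].
(* The level has to be even, since player [false] makes her promise with the move played there. *)
have eK : ~~ odd k.*2 by rewrite odd_double.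
have kK : k <= k.*2 by rewrite -addnn leq_addr.
exists (closed_game [set p | forall x, is_play x -> x (lev p) = p -> B x] eK).
exists (cov_le (closed_cov _ eK) kK); exact: (closed_cov_clopen eK oB erefl).
Qed.

Lemma unravelableC (T : game) (A : set (nat -> T)) : unravelable A -> unravelable (~` A).
Proof.
move=> H T' m k; have [T'' [c [h1 h2]]] := H T' m k.
exists T'', c; split=> // x px /= Ax; have [|n Hn] := h1 x px; first exact: contrapT.
by exists n => y py e; apply; exact: Hn.
Qed.

(** The agreement levels [k + i] tend to infinity, so the tower has a limit. Every [A i] becomes
    clopen there, hence the union open, and one more covering makes it clopen. *)
Lemma unravelable_bigcup (T : game) (A : nat -> set (nat -> T)) :
  (forall i, unravelable (A i)) -> unravelable (\bigcup_i A i).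
Proof.
move=> H T' m k.
have next i (X : {S : game & game_map S T'}) :
    {Y : {S' : game & covering (k + i) S' (projT1 X)} |
     clopen_set [set x | A i (m \o (projT2 X \o (cov_map (projT2 Y) \o x)))]}.
  apply: cid; have [S' [c Hc]] := H i _ (game_map_comp m (projT2 X)) (k + i).
  by exists (existT _ S' c).
pose fix tower i : {S : game & game_map S T'} :=
  if i is i'.+1 then
    let Y := sval (next i' (tower i')) in
    existT _ (projT1 Y) (game_map_comp (projT2 (tower i')) (cov_game_map (projT2 Y)))
  else existT _ T' (game_map_id T').
pose S i := projT1 (tower i).
pose c i : covering (k + i) (S i.+1) (S i) := projT2 (sval (next i (tower i))).
have kS i : k + i <= k + i.+1 by rewrite addnS.
have ki i : i <= k + i by exact: leq_addl.
pose L := limit_game c kS ki.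
pose B : set (nat -> L) := \bigcup_i [set x | A i (m \o (limit_proj c kS ki 0 \o x))].
have projE i (f : L) : projT2 (tower i) (limit_proj c kS ki i f) = limit_proj c kS ki 0 f.
  elim: i => [//|i IH]; rewrite -IH /=.
  exact: (congr1 (projT2 (tower i)) (svalP f i)).
have oB : open_set B.
  move=> x px [i _ Ai].
  have [h _] := clopen_game_map (limit_proj c kS ki i.+1) (svalP (next i (tower i))).
  have E y : (projT2 (tower i) \o (cov_map (c i) \o (limit_proj c kS ki i.+1 \o y)))
     = limit_proj c kS ki 0 \o y.
    by apply/funext => n; exact: (etrans (congr1 (projT2 (tower i)) (svalP (y n) i)) (projE i (y n))).
  have [|n Hn] := h x px; first by rewrite /= E.
  by exists n => y py e; exists i => //; have := Hn y py e; rewrite /= E.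
have [L' [c' Hc']] := unravelable_open oB (game_map_id L) k.
have k0 : k <= k + 0 by rewrite addn0.
exists L', (cov_comp c' (cov_le (limit_cov c kS ki) k0)).
have -> : [set x | (\bigcup_i A i) (m \o (cov_map (cov_comp c' (cov_le (limit_cov c kS ki) k0)) \o x))]
  = [set x | B (game_map_id L \o (cov_map c' \o x))] by [].
exact: Hc'.
Qed.

(** The Gale-Stewart argument in the unraveled game, whose payoff is open; the covering carries the
    winning strategy back. *)
Theorem unravelable_determined (T : game) (A : set (nat -> T)) : unravelable A ->
  (exists2 s, valid s & forall x, is_play x -> follows false s 0 x -> A x) \/
  (exists2 s, valid s & forall x, is_play x -> follows true s 0 x -> ~ A x).
Proof.
move=> /(_ T (game_map_id T) 0)[T' [c [oB _]]]; set B := [set x | _] in oB.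
pose W : set T' := [set p | forall x, is_play x -> x (lev p) = p -> B x].
have trans b s (P : set (nat -> T)) : valid s -> (forall x', is_play x' -> follows b s 0 x' -> P (cov_map c \o x')) ->
    forall x, is_play x -> follows b (cov_strategy c b s) 0 x -> P x.
  move=> vs HP x px fx; have [x' [px' fx' e]] := @cov_strategy_lift _ _ _ c b _ x vs px fx.
  by have <- : cov_map c \o x' = x; [exact/funext | exact: HP].
have [F|nF] := pselect (force false setT W (root T')); [left|right].
  have [s [vs Hs]] := force_strategy F; exists (cov_strategy c false s); first exact: cov_strategy_valid.
  apply: trans => // x px fx; have [||n [_ Wn _]] := Hs x px.
  - by rewrite lev_root px.1.
  - by move=> n _ _ on; exact: fx.
  - by apply: Wn; rewrite ?play_lev.
have [s vs Hs] : exists2 s, valid s & forall p, odd (lev p) ->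
    ~ force false setT W p -> ~ force false setT W (s p).
  have /choice[s Hs] : forall p, exists q, child q p /\ (odd (lev p) ->
      ~ force false setT W p -> ~ force false setT W q).
    move=> p; have [[q cq nq]|no] := pselect (exists2 q, child q p & ~ force false setT W q).
      by exists q.
    have [q cq] := child_ex p; exists q; split=> // op np; case: no.
    by apply: nforce_other => //; rewrite op.
  by exists s => p; [case: (Hs p) | move=> op; case: (Hs p) => _; exact].
exists (cov_strategy c true s); first exact: cov_strategy_valid.
apply: (@trans true s (fun x => ~ A x)) => // x px fx Bx.
have nFx n : ~ force false setT W (x n).
  elim: n => [|n IH]; first by rewrite px.1.
  have [on|en] := boolP (odd n); first by rewrite fx //; apply: Hs; rewrite ?play_lev.
  by apply: (nforce_own _ IH _ (px.2 n)) => //; rewrite play_lev //; exact/negbTE.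
have [n Hn] := oB x px Bx; apply: (nFx n); apply: ForceHit => // y py.
by rewrite play_lev // => e; exact: Hn.
Qed.

(** * Sigma-classes and words in free products *)

Section SigmaClass.
Variable T : Type.

Record sigma_class (B : set (set T)) := SigmaClass {
  sc0 : B set0;
  scC : forall A, B A -> B (~` A);
  sc_bigcup : forall F : nat -> set T, (forall n, B (F n)) -> B (\bigcup_n F n) }.

Variables (B : set (set T)) (sB : sigma_class B).

Lemma sc_ex U (f : U -> nat) (P : U -> set T) : injective f ->
  (forall u, B (P u)) -> B [set y | exists u, P u y].
Proof.
move=> fI BP.
have -> : [set y | exists u, P u y] = \bigcup_n [set y | exists2 u, f u = n & P u y].
  apply/seteqP; split=> y [u]; first by exists (f u) => //; exists u.
  by move=> _ [v _ Pv]; exists v.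
apply: sc_bigcup => // n; have [[u <-]|no] := pselect (exists u, f u = n).
  rewrite [X in B X](_ : _ = P u) //; apply/seteqP; split=> y; last by exists u.
  by case=> v /fI ->.
rewrite [X in B X](_ : _ = set0); first exact: sc0.
by rewrite -subset0 => y [u e _]; apply: no; exists u.
Qed.

Lemma sc_all U (f : U -> nat) (P : U -> set T) : injective f ->
  (forall u, B (P u)) -> B [set y | forall u, P u y].
Proof.
move=> fI BP; rewrite [X in B X](_ : _ = ~` [set y | exists u, (~` P u) y]).
  by apply: scC => //; apply: (sc_ex fI) => u; exact: scC.
apply/seteqP; split=> y /= H; first by case=> u; apply.
by move=> u; apply: contrapT => nP; apply: H; exists u.
Qed.

Lemma sc_or (P Q : set T) : B P -> B Q -> B [set y | P y \/ Q y].
Proof.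
move=> BP BQ; rewrite [X in B X](_ : _ = [set y | exists b : bool, (if b then P else Q) y]).
  by apply: (@sc_ex _ nat_of_bool) => [[] []|[]].
by apply/seteqP; split=> y; [case=> h; [exists true | exists false] | case=> -[] h; [left | right]].
Qed.

Lemma sc_and (P Q : set T) : B P -> B Q -> B [set y | P y /\ Q y].
Proof.
move=> BP BQ; rewrite [X in B X](_ : _ = [set y | forall b : bool, (if b then P else Q) y]).
  by apply: (@sc_all _ nat_of_bool) => [[] []|[]].
apply/seteqP; split=> y; first by case=> ? ? [].
by move=> /= h; split; [have := h true | have := h false].
Qed.

Lemma sc_cst (Q : Prop) : B [set y | Q].
Proof.
have [q|nq] := pselect Q.
  rewrite [X in B X](_ : _ = ~` set0); first by apply: scC => //; exact: sc0.
  by apply/seteqP; split=> // y _; exact.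
rewrite [X in B X](_ : _ = set0); first exact: sc0.
by rewrite -subset0 => y.
Qed.

Lemma sc_imp (P Q : set T) : B P -> B Q -> B [set y | P y -> Q y].
Proof.
move=> BP BQ; rewrite [X in B X](_ : _ = [set y | (~` P) y \/ Q y]).
  by apply: sc_or => //; exact: scC.
apply/seteqP; split=> y /=; last by case=> // np /np.
by move=> h; have [p|np] := pselect (P y); [right; exact: h | left].
Qed.

End SigmaClass.

Section FreeProductWords.
Variables (I : choiceType) (G : I -> groupType).
Local Notation FP := (free_product G).
Implicit Types (a b : letter G) (v w : seq (letter G)) (x u g : FP).
Local Open Scope group_scope.

Definition word_prod w : FP := foldr (fun a x => fp_of (tagged a) * x) 1 w.

Definition len x := size (fp_word x).

Lemma word_prod_cat v w : word_prod (v ++ w) = word_prod v * word_prod w.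
Proof. by elim: v => [|a v IH] /=; rewrite ?mul1g // IH mulgA. Qed.

Lemma word_of_mul i (g : G i) x :
  fp_word (fp_of g * x) = cons_letter (Tagged G g) (fp_word x).
Proof. exact: (mul_cons_letter (Tagged G g) (v := [::]) isT (fp_reduced x)). Qed.

Lemma reduced_behead a w : reduced (a :: w) -> reduced w.
Proof. by case/andP => /andP[_ h1] /path_sorted h2; apply/andP. Qed.

Lemma cons_letter_red a w : reduced (a :: w) -> cons_letter a w = a :: w.
Proof.
case/andP => /andP[a1 _]; rewrite /cons_letter (negbTE a1).
by case: w => //= b w /andP[/negbTE-> _].
Qed.

Lemma word_of_prod w : reduced w -> fp_word (word_prod w) = w.
Proof.
elim: w => [//|[i g] w IH] rw.
rewrite [word_prod _]/= word_of_mul IH ?(reduced_behead rw) //.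
exact: cons_letter_red.
Qed.

Lemma word_prodK x : word_prod (fp_word x) = x.
Proof. by apply: val_inj; exact: (word_of_prod (fp_reduced x)). Qed.

Lemma size_cons_letter a w : size (cons_letter a w) <= (size w).+1.
Proof.
rewrite /cons_letter; case: ifP => // _; case: w => //= b w.
by do 2?[case: ifP => _] => //=; rewrite leqW.
Qed.

Lemma len_word_prod w : len (word_prod w) <= size w.
Proof.
elim: w => [//|[i g] w IH]; rewrite [word_prod _]/= /len word_of_mul.
by apply: leq_trans (size_cons_letter _ _) _; rewrite ltnS.
Qed.

Lemma len_eq0 x : len x = 0 -> x = 1.
Proof. by move=> /size0nil e; rewrite -(word_prodK x) e. Qed.

Definition nth_tag x p : option I := omap tag (onth (fp_word x) p).

Lemma nth_tag_lt x p : p < len x -> exists j, nth_tag x p = Some j.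
Proof.
rewrite /nth_tag /len; elim: (fp_word x) p => // a w IH [|p] /=; first by exists (tag a).
by rewrite ltnS; exact: IH.
Qed.

Lemma nth_tag_split x p j : nth_tag x p = Some j -> exists g : G j,
  fp_word x = take p (fp_word x) ++ Tagged G g :: drop p.+1 (fp_word x).
Proof.
rewrite /nth_tag; elim: (fp_word x) p => [|a w IH] [|p] //=.
  by case: a => i g [<-]; exists g; rewrite drop0.
by move=> /IH[g e]; exists g; rewrite -e.
Qed.

Lemma nth_tag_adjacent x p j : nth_tag x p = Some j -> nth_tag x p.+1 <> Some j.
Proof.
rewrite /nth_tag; have /andP[_] := fp_reduced x.
elim: (fp_word x) p => [|a w IH] [|p] //=; last first.
  by move/path_sorted => h; exact: IH.
case: w {IH} => //= b w /andP[ab _] [e1] [e2]; by rewrite e1 e2 eqxx in ab.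
Qed.

(** The path labelled [u] from a point [y] runs through the shifts of [y] by the inverses of these
    prefixes; it closes up if [u] fixes [y]. *)
Definition prefix_prod u p := word_prod (take p (fp_word u)).

Lemma prefix_prod0 u : prefix_prod u 0 = 1. Proof. by rewrite /prefix_prod take0. Qed.

Lemma prefix_prod_len u : prefix_prod u (len u) = u. Proof. by rewrite /prefix_prod take_size word_prodK. Qed.

Lemma nth_tag_lt_len x p j : nth_tag x p = Some j -> p < len x.
Proof.
rewrite /nth_tag /len; elim: (fp_word x) p => [|a w IH] [|p] //= h; exact: IH.
Qed.

Lemma prefix_prodS u p j : nth_tag u p = Some j -> exists g : G j, prefix_prod u p.+1 = prefix_prod u p * fp_of g.
Proof.
move=> h; have [g e] := nth_tag_split h; exists g; have lp := nth_tag_lt_len h.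
have sp : size (take p (fp_word u)) = p by rewrite size_takel // ltnW.
rewrite /prefix_prod {1}e -cat_rcons take_size_cat ?size_rcons ?sp //.
by rewrite -cats1 word_prod_cat /= mulg1.
Qed.

Lemma nth_tag_last x j : nth_tag x (len x).-1 = Some j ->
  exists (g : G j) y, x = y * fp_of g /\ len y < len x.
Proof.
move=> h; have lx := nth_tag_lt_len h; have [g e] := prefix_prodS h.
have l0 : 0 < len x by apply: leq_ltn_trans lx.
exists g, (prefix_prod x (len x).-1); rewrite -e prednK // prefix_prod_len; split=> //.
by apply: leq_ltn_trans (len_word_prod _) _; rewrite size_takel // ltnW.
Qed.

Lemma len_fp_of i (g : G i) : len (fp_of g) <= 1.
Proof. exact: size_cons_letter. Qed.

Lemma len_mul x y : len (x * y) <= len x + len y.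
Proof.
rewrite -{1}(word_prodK x) -{1}(word_prodK y) -word_prod_cat.
by apply: leq_trans (len_word_prod _) _; rewrite size_cat.
Qed.

End FreeProductWords.

(** * A Borel choice of a factor at every non-free point *)

Section NonFreeColoring.
Variables (I : choiceType) (G : I -> groupType).
Local Notation FP := (free_product G).
Local Notation point := (shift_space cantor_space FP).
Local Notation label := (FP * seq (FP * nat * bool))%type.
Variable dec : nat -> label.
Hypothesis dec_surj : forall l, exists k, dec k = l.
Implicit Types (x y z : point) (g u d : FP) (s : seq (FP * nat * bool)).
Local Open Scope group_scope.

Definition in_box s y := all (fun t => y t.1.1 t.1.2 == t.2) s.

(* [y] is the base point of a cycle in its orbit, labelled by the cyclically
   reduced word [u] of its edges and a clopen box [s] containing no other point
   from which the [u]-cycle through [y] could be entered. Hence two cycles with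
   the same label are disjoint or equal. *)
Definition good_for u s y :=
  [/\ u <> 1, shift u y = y, in_box s y,
      forall p q, p < len u -> q < len u ->
        in_box s (shift (prefix_prod u q * (prefix_prod u p)^-1) y) -> p = q &
      len u = 1%N \/ nth_tag u 0 <> nth_tag u (len u).-1].

Definition good k y := good_for (dec k).1 (dec k).2 y.

(** Place [p] on the [k]-labelled cycle whose base point is obtained by walking back along the
    prefix. *)
Definition core k y p := p < len (dec k).1 /\ good k (shift (prefix_prod (dec k).1 p) y).

Definition min_label k y := (exists d, good k (shift d y)) /\
  forall k', k' < k -> ~ exists d, good k' (shift d y).

Definition toward k y j :=
  (exists p, core k y p /\ nth_tag (dec k).1 p = Some j) \/
  ((~ exists p, core k y p) /\ exists d,
     [/\ nth_tag d (len d).-1 = Some j, exists p, core k (shift d y) p &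
       forall d', len d' < len d -> ~ exists p, core k (shift d' y) p]).

(* Among the cycles carrying the least label of the orbit, a point on a cycle
   chooses the factor of the next edge, and any other point that of the first
   edge of a shortest path to a cycle. No orbit of a factor acting freely on it
   is then chosen by all its points. *)
Definition color y j := exists k, min_label k y /\ toward k y j.

Lemma len_gt0 u : u <> 1 -> 0 < len u.
Proof. by case e : (len u) => // u1; case: u1; exact: len_eq0. Qed.

Lemma shift_inv_fix u y : shift u y = y -> shift u^-1 y = y.
Proof. by move=> e; rewrite -{1}e -shiftM mulVg shift1. Qed.

Lemma core_next k y p j : core k y p -> nth_tag (dec k).1 p = Some j ->
  exists g : G j, core k (shift (fp_of g)^-1 y)
    (if p.+1 < len (dec k).1 then p.+1 else 0) /\
    prefix_prod (dec k).1 p.+1 = prefix_prod (dec k).1 p * fp_of g.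
Proof.
case=> lp gk tp; have [g e] := prefix_prodS tp; exists g; split=> //.
case: ltnP => [lp1|pn]; first by split=> //; rewrite -shiftM e mulgK.
have en : len (dec k).1 = p.+1 by apply/eqP; rewrite eqn_leq pn lp.
split; first by rewrite en.
have [_ uv _ _ _] := gk; rewrite prefix_prod0 shift1; move: (gk).
rewrite -{1}(shift_inv_fix uv) -shiftM.
suff -> : (dec k).1^-1 * prefix_prod (dec k).1 p = (fp_of g)^-1 by [].
by rewrite -{1}(prefix_prod_len (dec k).1) en e invgM mulgVK.
Qed.

(** This is the purpose of the box: both base points lie in it, and the box contains only one point
    of a cycle. *)
Lemma core_uniq k y p q : core k y p -> core k y q -> p = q.
Proof.
case=> lp [_ _ _ H _] [lq [_ _ bq _ _]]; apply: H => //.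
by rewrite -shiftM mulgVK.
Qed.

Lemma min_label_uniq k k' y g : min_label k y -> min_label k' (shift g y) -> k = k'.
Proof.
move=> [[d hd] H] [[d' hd'] H']; apply/eqP; rewrite eqn_leq.
apply/andP; split; rewrite leqNgt; apply/negP => lt.
  by apply: (H _ lt); exists (d' * g); rewrite shiftM.
by apply: (H' _ lt); exists (d * g^-1); rewrite -shiftM mulgVK.
Qed.

Lemma min_classic (P : nat -> Prop) : (exists n, P n) ->
  exists n, P n /\ forall m, P m -> n <= m.
Proof.
case=> n0 Pn0; have ex : exists n, `[< P n >] by exists n0; exact/asboolP.
by case: (ex_minnP ex) => n /asboolP Pn H; exists n; split=> // m /asboolP; exact: H.
Qed.

(** Take a point of the [G j]-orbit nearest to a cycle. Off the cycles, its chosen edge leads inside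
    the orbit to a nearer point. On a cycle, it leads to a cycle point of the same orbit whose next
    edge is again in [G j]: impossible in a cyclically reduced word, unless the cycle has length one
    and gives a nontrivial element of [G j] fixing [y]. *)
Lemma color_avoid y j :
  (forall g : G j, g <> 1 -> shift (fp_of g) y <> y) ->
  ~ forall g : G j, color (shift (fp_of g) y) j.
Proof.
move=> fr col.
have [k [mk _]] : color y j by have := col 1; rewrite gmulf1 shift1.
have {}col (g : G j) : toward k (shift (fp_of g) y) j.
  by have [k' [mk' tk]] := col g; rewrite (min_label_uniq mk mk').
pose P n := exists (g : G j) d' p, len d' = n /\ core k (shift d' (shift (fp_of g) y)) p.
have [n [[g [d' [p [ld cd]]]] Hd]] : exists n, P n /\ forall m, P m -> n <= m.
  apply: min_classic; have [[d hd] _] := mk; exists (len d), 1, d, 0; split=> //.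
  rewrite gmulf1 shift1; split; last by rewrite prefix_prod0 shift1.
  by apply: len_gt0; case: hd.
have [d0|dp] := posnP n.
  rewrite d0 in ld; rewrite (len_eq0 ld) shift1 in cd.
  have [[q [cq tq]]|[[]]] := col g; last by exists p.
  have e := core_uniq cq cd; subst q.
  have [h [cn ph]] := core_next cd tq.
  rewrite -gmulfV -shiftM -gmulfM in cn.
  have [[q [cq' tq']]|[[]]] := col (h^-1 * g); last by eexists; exact: cn.
  have e := core_uniq cq' cn; subst q.
  case: ifP tq' => [_ tq'|lt tq']; first by case: (nth_tag_adjacent tq).
  have [lp [u1 uv _ _ lst]] := cd.
  have en : len (dec k).1 = p.+1 by apply/eqP; rewrite eqn_leq lp andbT leqNgt lt.
  case: lst => [l1|]; last by rewrite en /= tq' tq.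
  have p0 : p = 0 by move: en; rewrite l1 => -[].
  have eu : (dec k).1 = fp_of h by rewrite -(prefix_prod_len (dec k).1) en ph p0 prefix_prod0 mul1g.
  rewrite p0 prefix_prod0 shift1 eu in uv.
  apply: (fr (g^-1 * h * g)) => [e|].
    have eh : h = g * (g^-1 * h * g) * g^-1 by rewrite !mulgA mulgV mul1g mulgK.
    by apply: u1; rewrite eu eh e mulg1 mulgV gmulf1.
  by rewrite !gmulfM !shiftM uv gmulfV -shiftM mulVg shift1.
have [[q [cq tq]]|[_ [d1 [t1 [p1 c1] m1]]]] := col g.
  by have := Hd 0; rewrite leqNgt dp => /(_ _)/negP[] //; exists g, 1, q; rewrite shift1.
have [h [d2 [e2 l2]]] := nth_tag_last t1.
have ld1 : len d1 <= n by rewrite leqNgt -ld; apply/negP => lt; apply: (m1 _ lt); exists p.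
have : n <= len d2.
  by apply: Hd; exists (h * g), d2, p1; split=> //; rewrite gmulfM -shiftM mulgA -e2 shiftM.
by rewrite leqNgt (leq_trans l2 ld1).
Qed.

(** The label is a shortest nontrivial word fixing some point of the orbit. Minimality makes the
    points of its cycle distinct and the word cyclically reduced; finitely many coordinates
    separating these points form the box. *)
Lemma good_exists y g : g <> 1 -> shift g y = y -> exists k d, good k (shift d y).
Proof.
move=> g1 gy.
pose P n := exists u d, [/\ u <> 1, shift u (shift d y) = shift d y & len u = n].
have [n [[u [d [u1 uv lu]]] Hn]] : exists n, P n /\ forall m, P m -> n <= m.
  by apply: min_classic; exists (len g), g, 1; rewrite shift1.
set v := shift d y in uv.
have minl u' d' : u' <> 1 -> shift u' (shift d' v) = shift d' v -> len u <= len u'.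
  by move=> u'1 e; rewrite lu; apply: Hn; exists u', (d' * d); split=> //; rewrite shiftM.
have dist p q : p < q -> q < len u -> shift (prefix_prod u p)^-1 v <> shift (prefix_prod u q)^-1 v.
  move=> pq qn e; set w := fp_word u.
  have switch : size w = len u by [].
  have sp : size (take p w) = p by rewrite size_takel // switch (leq_trans (ltnW pq) (ltnW qn)).
  pose seg := word_prod (take (q - p) (drop p w)).
  have eq : prefix_prod u q = prefix_prod u p * seg.
    by rewrite /seg -word_prod_cat -takeD subnKC // ltnW.
  have lseg : len seg <= q - p.
    by apply: leq_trans (len_word_prod _) _; rewrite size_take_min geq_minl.
  (* Deleting a trivial segment would give a shorter word for [u]. *)
  have seg1 : seg <> 1.
    move=> s1; have eu : u = word_prod (take p w ++ drop q w).
      rewrite word_prod_cat -[word_prod (take p w)]mulg1 -s1 -[_ * seg]eq -word_prod_cat cat_take_drop.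
      by rewrite word_prodK.
    have : len u <= p + (len u - q).
      by rewrite {1}eu; apply: leq_trans (len_word_prod _) _; rewrite size_cat sp size_drop.
    by rewrite addnBA ?(ltnW qn) // leqNgt ltn_subLR ?ltn_add2r ?pq //;
      apply: leq_trans (ltnW qn) (leq_addl _ _).
  have : len u <= len seg.
    apply: (minl seg (prefix_prod u p)^-1 seg1); rewrite {1}e eq invgM shiftM -shiftM mulgV shift1 //.
  move=> /leq_trans/(_ lseg); rewrite leqNgt; apply/negP/negPn.
  by apply: leq_ltn_trans (leq_subr _ _) qn.
have sep p q : exists t : FP * nat, p < len u -> q < len u -> p != q ->
    shift (prefix_prod u q * (prefix_prod u p)^-1) v t.1 t.2 != v t.1 t.2.
  have [[t Ht]|no] := pselect (exists t : FP * nat,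
    shift (prefix_prod u q * (prefix_prod u p)^-1) v t.1 t.2 != v t.1 t.2); first by exists t.
  exists (1, 0) => lp lq npq; case: no; apply: contrapT => no.
  have e : shift (prefix_prod u q * (prefix_prod u p)^-1) v = v.
    apply/funext => h; apply/funext => m; apply/eqP/negPn/negP => nh.
    by apply: no; exists (h, m).
  have {}e : shift (prefix_prod u p)^-1 v = shift (prefix_prod u q)^-1 v.
    by rewrite -[in RHS]e -shiftM mulKg.
  by move: npq; rewrite neq_ltn => /orP[] lt; [exact: (dist p q) | exact: (dist q p)].
have /choice[F HF] : forall pq : nat * nat, exists t : FP * nat,
    pq.1 < len u -> pq.2 < len u -> pq.1 != pq.2 ->
    shift (prefix_prod u pq.2 * (prefix_prod u pq.1)^-1) v t.1 t.2 != v t.1 t.2.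
  by case=> p q; exact: sep.
pose s : seq (FP * nat * bool) :=
  [seq (F (p, q), v (F (p, q)).1 (F (p, q)).2) | p <- iota 0 (len u), q <- iota 0 (len u)].
have [k ek] := dec_surj (u, s); exists k, d; rewrite /good ek /= -/v; split=> //.
- by apply/allP => t /allpairsP[[p q] [_ _ ->]] /=.
- move=> p q lp lq /allP H; apply/eqP; apply/negPn/negP => npq.
  have := HF (p, q) lp lq npq; rewrite /= => /negP; apply.
  apply: (H (F (p, q), v (F (p, q)).1 (F (p, q)).2)).
  by apply: allpairs_f; rewrite mem_iota.
- have [l1|nl1] := eqVneq (len u) 1%N; first by left.
  (* If both end letters came from one factor, conjugating by the first would merge them and give a
     shorter word fixing a point of the orbit. *)
  right; have lu0 := len_gt0 u1.
  have l2 : 1 < len u by rewrite ltn_neqAle eq_sym nl1.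
  have [j tj] := nth_tag_lt lu0; rewrite tj => /esym tl.
  have [a ea] := prefix_prodS tl; rewrite prednK // prefix_prod_len in ea.
  have [b eb] := prefix_prodS tj; rewrite prefix_prod0 mul1g in eb.
  pose m := word_prod (drop 1 (take (len u).-1 (fp_word u))).
  have em : prefix_prod u (len u).-1 = fp_of b * m.
    rewrite -eb /prefix_prod -(@take_takel _ 1 (len u).-1); last by rewrite -ltnS prednK.
    by rewrite -word_prod_cat cat_take_drop.
  have eu : (fp_of b)^-1 * u * fp_of b = m * fp_of (a * b).
    by rewrite {1}ea em gmulfM !mulgA mulVg mul1g.
  have : len u <= len (m * fp_of (a * b)).
    rewrite -eu; apply: (minl _ (fp_of b)^-1) => [e|].
      have eh : u = fp_of b * ((fp_of b)^-1 * u * fp_of b) * (fp_of b)^-1.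
        by rewrite !mulgA mulgV mul1g mulgK.
      by apply: u1; rewrite eh e mulg1 mulgV.
    by rewrite -shiftM mulgK shiftM uv.
  rewrite leqNgt => /negP; apply; apply: leq_ltn_trans (len_mul _ _) _.
  apply: leq_ltn_trans (leq_add (len_word_prod _) (len_fp_of _)) _.
  rewrite size_drop size_takel ?leq_pred // addn1 subn1.
  have lp : 0 < (len u).-1 by rewrite -ltnS prednK.
  by rewrite (prednK lp) prednK.
Qed.

Lemma color_exists y g : g <> 1 -> shift g y = y -> exists j, color y j.
Proof.
move=> g1 gy; have [k0 [d0 gk0]] := good_exists g1 gy.
have [k [hk Hk]] : exists k, (exists d, good k (shift d y)) /\
    forall k', (exists d, good k' (shift d y)) -> k <= k'.
  by apply: min_classic; exists k0, d0.
have mk : min_label k y.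
  by split=> // k' lt h; move: (Hk _ h); rewrite leqNgt lt.
pose P n := exists d p, core k (shift d y) p /\ len d = n.
have [n [[d [p [cd ld]]] Hn]] : exists n, P n /\ forall m, P m -> n <= m.
  apply: min_classic; have [d hd] := hk; exists (len d), d, 0; split=> //; split.
    by apply: len_gt0; case: hd.
  by rewrite prefix_prod0 shift1.
have [n0|n_gt0] := posnP n.
  rewrite n0 in ld; rewrite (len_eq0 ld) shift1 in cd.
  have [j tj] := nth_tag_lt cd.1.
  by exists j, k; split=> //; left; exists p.
have ldp : (len d).-1 < len d by rewrite ld prednK.
have [j tj] := nth_tag_lt ldp; exists j, k; split=> //; right; split.
  case=> q cq; have := Hn 0; rewrite leqNgt n_gt0 => /(_ _)/negP[] //.
  by exists 1, q; rewrite shift1.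
exists d; split=> //; first by exists p.
by move=> d' lt [q cq]; move: lt; rewrite ltnNge ld => /negP; apply; apply: Hn; exists d', q.
Qed.

Section Measurable.
Variable (B : set (set point)) (code : FP -> nat).
Hypotheses (sB : sigma_class B) (code_inj : injective code).
Hypothesis B_bit : forall h m b, B [set y | y h m = b].

Lemma B_eqshift g g' : B [set y | shift g y = shift g' y].
Proof.
rewrite [X in B X](_ : _ = [set y | forall h m, exists b : bool,
    y (g^-1 * h) m = b /\ y (g'^-1 * h) m = b]).
  apply: (sc_all sB code_inj) => h; apply: (sc_all sB (f := id)) => // m.
  apply: (sc_ex sB (f := nat_of_bool)) => [[] []|b] //.
  by apply: (sc_and sB); exact: B_bit.
apply/seteqP; split=> y /= H.
  by move=> h m; exists (y (g^-1 * h) m); split=> //; exact: (esym (congr1 (fun z : point => z h m) H)).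
by apply/funext => h; apply/funext => m; have [b [e1 e2]] := H h m; rewrite /shift e1 e2.
Qed.

Let B_box s g : B [set y | in_box s (shift g y)].
Proof.
elim: s => [|t s IH]; first exact: (sc_cst sB true).
rewrite [X in B X](_ : _ = [set y : point | y (g^-1 * t.1.1) t.1.2 = t.2 /\ in_box s (shift g y)]).
  by apply: (sc_and sB) => //; exact: B_bit.
by apply/seteqP; split=> y /=; rewrite /in_box /=; [case/andP=> /eqP | case=> /eqP-> ->].
Qed.

Let B_good k g : B [set y | good k (shift g y)].
Proof.
rewrite /good; case: (dec k) => u s /=.
rewrite [X in B X](_ : _ = [set y | u <> 1 /\ (shift (u * g) y = shift g y /\
   (in_box s (shift g y) /\ ((forall p q, p < len u -> q < len u ->
     in_box s (shift (prefix_prod u q * (prefix_prod u p)^-1 * g) y) -> p = q) /\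
     (len u = 1%N \/ nth_tag u 0 <> nth_tag u (len u).-1))))]).
  apply: (sc_and sB); first exact: (sc_cst sB).
  apply: (sc_and sB); first exact: B_eqshift.
  apply: (sc_and sB); first exact: B_box.
  apply: (sc_and sB); last exact: (sc_cst sB).
  apply: (sc_all sB (f := id)) => // p; apply: (sc_all sB (f := id)) => // q.
  do 2![apply: (sc_imp sB); first exact: (sc_cst sB)].
  by apply: (sc_imp sB); [exact: B_box | exact: (sc_cst sB)].
apply/seteqP; split=> y /=.
  by case; rewrite -shiftM => h1 h2 h3 h4 h5; do !split=> //; move=> p q lp lq; rewrite shiftM; exact: h4.
by case=> h1 [h2 [h3 [h4 h5]]]; split=> //; rewrite -?shiftM // => p q lp lq; rewrite -shiftM; exact: h4.
Qed.

Let B_core k g p : B [set y | core k (shift g y) p].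
Proof.
apply: (sc_and sB) => //; first exact: (sc_cst sB).
rewrite [X in B X](_ : _ = [set y | good k (shift (prefix_prod (dec k).1 p * g) y)]) //.
by apply/seteqP; split=> y /=; rewrite shiftM.
Qed.

Let B_core_ex k g : B [set y | exists p, core k (shift g y) p].
Proof. by apply: (sc_ex sB (f := id)) => // p; exact: B_core. Qed.

Lemma B_color j : B [set y | color y j].
Proof.
pose E k : set point := [set y | exists d, good k (shift d y)].
have BE k : B (E k) by apply: (sc_ex sB code_inj) => d; exact: B_good.
have -> : [set y | color y j] = [set y | exists k, (E k y /\ forall k', k' < k -> (~` E k') y) /\
  ((exists p, core k (shift 1 y) p /\ nth_tag (dec k).1 p = Some j) \/
   ((~` [set y | exists p, core k (shift 1 y) p]) y /\ exists d,
     nth_tag d (len d).-1 = Some j /\ ((exists p, core k (shift d y) p) /\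
       forall d', len d' < len d -> (~` [set y | exists p, core k (shift d' y) p]) y)))].
  apply/seteqP; split=> y /= [k [mk tk]]; exists k; split=> //; rewrite ?shift1 in tk *.
    by case: tk => [?|[? [d [? ? ?]]]]; [left | right; split=> //; exists d].
  by case: tk => [?|[? [d [? [? ?]]]]]; [left | right; split=> //; exists d].
apply: (sc_ex sB (f := id)) => // k; apply: (sc_and sB) => //.
  apply: (sc_and sB) => //; apply: (sc_all sB (f := id)) => // k'.
  by apply: (sc_imp sB) => //; [exact: (sc_cst sB) | exact: (scC sB)].
apply: (sc_or sB) => //.
  by apply: (sc_ex sB (f := id)) => // p; apply: (sc_and sB); [exact: B_core | exact: (sc_cst sB)].
apply: (sc_and sB) => //; first exact: (scC sB).
apply: (sc_ex sB code_inj) => d; apply: (sc_and sB) => //; first exact: (sc_cst sB).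
apply: (sc_and sB); first exact: B_core_ex.
apply: (sc_all sB code_inj) => d'.
by apply: (sc_imp sB) => //; [exact: (sc_cst sB) | exact: (scC sB)].
Qed.
End Measurable.

End NonFreeColoring.

(** * The game on the free product *)

Section MarksGame.
Variables (I : choiceType) (G : I -> groupType) (pl : nat -> option I).
Variable num : letter G -> nat.
Hypothesis num_inj : injective num.
Local Notation FP := (free_product G).
Local Notation point := (shift_space cantor_space FP).
Implicit Types (w v : seq (letter G)) (m n t k l : nat) (al be : FP).

(** At the identity, the three numbers are the owner of the bit, its block and its place in the
    block. *)
Definition bit_code n : nat * nat * nat := odflt (0, 0, 0) (unpickle n).
Definition code_bit (i k l : nat) : nat := pickle (i, k, l).

Lemma code_bitK i k l : bit_code (code_bit i k l) = (i, k, l).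
Proof. by rewrite /bit_code pickleK. Qed.

Definition weight w := sumn [seq (num a).+1 | a <- w].
(* The bit [m] at the word [w] is played in round [turn w m]. The powers of two
   leave time for every word of weight below [2 ^ k] to be played in reaction to
   the [k]-th block of bits at the identity before the next block starts. *)
Definition turn w m := weight w + 2 ^ (bit_code m).1.2.
Definition own w m := if w is a :: _ then Some (tag a) else pl (bit_code m).1.1.

(** A full table of bits, of which [bit] reads only the entries whose turn it is. *)
Definition move := seq (letter G) -> nat -> bool.
Definition no_move : move := fun _ _ => false.

Definition marks_game : game.
Proof.
apply: (@Game (seq move) behead size [::]) => //.
- by move=> p /size0nil.
- exact: size_behead.
- by move=> p; exists (no_move :: p).
Defined.

Local Notation T := marks_game.
Implicit Types (h : seq move) (s : T -> T) (x : nat -> T).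

(** Positions list the latest move first, so moves are counted from the end. *)
Definition nth_move h n : move := nth no_move h (size h - n.+1).

Definition bit j h w m : bool :=
  nth_move h (if own w m == Some j then (turn w m).*2 else (turn w m).*2.+1) w m.

Definition outcome j x : point :=
  fun al m => bit j (x (turn (fp_word al) m).+1.*2) (fp_word al) m.

Lemma nth_move_cons p h n : n < size h -> nth_move (p :: h) n = nth_move h n.
Proof. by move=> lt; rewrite /nth_move /= subSn. Qed.

Lemma nth_move_last p h : nth_move (p :: h) (size h) = p.
Proof. by rewrite /nth_move /= subnn. Qed.

Lemma validE s p : valid s -> s p = head no_move (s p) :: p.
Proof. by move=> vs; have [/= e1 e2] := vs p; case: (s p) e1 e2 => //= a q ->. Qed.

Lemma bit_lt j w m t : turn w m < t ->
  (if own w m == Some j then (turn w m).*2 else (turn w m).*2.+1) < t.*2.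
Proof.
move=> lt; case: ifP => _; first by rewrite ltn_double.
by rewrite -ltnS -doubleS ltnS leq_double.
Qed.

Section JointPlay.
Variable s : I -> T -> T.
Hypothesis vs : forall i, valid (s i).

(** Each player opens the round in its own game, so all these moves can be collected before any team
    has to answer; the collection is the answer of every team. *)
Fixpoint joint t (i : I) : seq move :=
  if t is t'.+1 then
    (fun w m => if own w m is Some i' then head no_move (s i' (joint t' i')) w m else false)
    :: s i (joint t' i)
  else [::].

Definition joint_point : point := fun al m =>
  let w := fp_word al in
  if own w m is Some i then head no_move (s i (joint (turn w m) i)) w m else false.

Definition joint_play i n : seq move :=
  if odd n then s i (joint n./2 i) else joint n./2 i.

Lemma size_joint t i : size (joint t i) = t.*2.
Proof. by elim: t => //= t IH; rewrite (validE _ (vs i)) /= IH. Qed.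

Lemma joint_play_play i : @is_play T (joint_play i).
Proof.
split=> // n; rewrite /joint_play /= uphalf_half; have [on|en] := boolP (odd n).
  by rewrite add1n.
by rewrite add0n; exact: vs.
Qed.

Lemma joint_play_follows i : follows false (s i) 0 (joint_play i).
Proof.
by move=> n _ on; rewrite /joint_play /= uphalf_half on add0n.
Qed.

Lemma outcome_joint i : outcome i (joint_play i) = joint_point.
Proof.
apply/funext => al; apply/funext => m; rewrite /outcome /joint_point /=.
set w := fp_word al; rewrite /joint_play odd_double doubleK /bit /=.
have sz : size (s i (joint (turn w m) i)) = (turn w m).*2.+1.
  by rewrite (validE _ (vs i)) /= size_joint.
have [e|ne] := eqVneq (own w m) (Some i).
  rewrite e nth_move_cons ?sz //; rewrite (validE _ (vs i)).
  by rewrite -(size_joint (turn w m) i) nth_move_last /=.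
by rewrite -sz nth_move_last.
Qed.

End JointPlay.

(** * One strategy of the team played at all vertices of a factor *)

Section TeamPlay.
Variables (j : I) (s : T -> T).
Hypothesis vs : valid s.
Implicit Types (g d : G j) (u : G j -> nat -> nat -> bool).
Local Open Scope group_scope.

Definition in_factor (a : letter G) : G j := tagged_as (Tagged G (1 : G j)) a.

Lemma in_factorE g : in_factor (Tagged G g) = g. Proof. exact: (@tagged_asE _ G (Tagged G (1 : G j)) g). Qed.

(* Player [j]'s next move at vertex [g] of the [G j]-orbit: its bits at the
   identity are prescribed by [u], and those at a word [a w] starting in [G j]
   are the bits at [w] of the play at the vertex [g a]. *)
Definition own_move u t (H : G j -> seq move) g : move := fun w m =>
  match w with
  | [::] => (2 ^ (bit_code m).1.2 == t)%N && u g (bit_code m).1.2 (bit_code m).2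
  | a :: w' => [&& turn w m == t, tag a == j & bit j (H (g * in_factor a)) w' m]
  end.

Lemma own_move_cons u H g g' w m :
  own_move u (turn (Tagged G g' :: w) m) H g (Tagged G g' :: w) m = bit j (H (g * g')) w m.
Proof. by rewrite /own_move !eqxx in_factorE. Qed.

Fixpoint history u t g : seq move :=
  if t is t'.+1 then s (own_move u t' (history u t') g :: history u t' g) else [::].

Definition team_play u g n : seq move :=
  if odd n then own_move u n./2 (history u n./2) g :: history u n./2 g else history u n./2 g.

Definition vertex_bit u g w m := bit j (history u (turn w m).+1 g) w m.

Definition team_point u : point := fun al m => vertex_bit u 1 (fp_word al) m.

Lemma size_history u t g : size (history u t g) = t.*2.
Proof. by elim: t => //= t IH; rewrite (validE _ vs) /= IH. Qed.

Lemma team_play_play u g : @is_play T (team_play u g).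
Proof.
split=> // n; rewrite /team_play /= uphalf_half; have [on|en] := boolP (odd n).
  by rewrite add1n; exact: vs.
by rewrite add0n.
Qed.

Lemma team_play_follows u g : follows true s 0 (team_play u g).
Proof. by move=> n _ on; rewrite /team_play /= uphalf_half on add1n. Qed.

Lemma bit_history u t g w m : turn w m < t -> bit j (history u t g) w m = vertex_bit u g w m.
Proof.
move=> lt; rewrite -(subnKC lt); elim: (t - _) => [|d IH]; first by rewrite addn0.
rewrite addnS -IH /= (validE _ vs) /bit; set n := if _ then _ else _.
have hn : n < ((turn w m).+1 + d).*2 by apply: bit_lt; rewrite ltnS leq_addr.
have hn' : n < size (history u ((turn w m).+1 + d) g) by rewrite size_history.
by rewrite nth_move_cons ?nth_move_cons //= ltnS ltnW.
Qed.

Lemma weight_cons a w : weight (a :: w) = (num a).+1 + weight w. Proof. by []. Qed.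

Lemma vertex_bit_own u g w m : own w m = Some j ->
  vertex_bit u g w m = own_move u (turn w m) (history u (turn w m)) g w m.
Proof.
move=> e; rewrite /vertex_bit /= (validE _ vs) /bit e eqxx.
by rewrite nth_move_cons /= -?(size_history u (turn w m) g) ?nth_move_last.
Qed.

Lemma vertex_bit_nil u g i k l : pl i = Some j -> vertex_bit u g [::] (code_bit i k l) = u g k l.
Proof.
by move=> e; rewrite vertex_bit_own /own ?code_bitK //= /turn code_bitK /= eqxx.
Qed.

(** Letters have positive weight, so the bit at [w] was played at the neighbouring vertex in an
    earlier round. *)
Lemma vertex_bit_cons u g g' w m : vertex_bit u g (Tagged G g' :: w) m = vertex_bit u (g * g') w m.
Proof.
rewrite vertex_bit_own // own_move_cons bit_history //.
by rewrite /turn weight_cons ltn_add2r addSn ltnS leq_addl.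
Qed.

Lemma vertex_bitM u g g' w m : vertex_bit u g (cons_letter (Tagged G g') w) m = vertex_bit u (g * g') w m.
Proof.
rewrite /cons_letter /=; have [->|g1] := eqVneq g' 1; first by rewrite mulg1.
case: w => [|[i x] w]; first by rewrite vertex_bit_cons.
have [e|ne] := eqVneq j i; last by rewrite vertex_bit_cons.
case: _ / e x => x; rewrite tagged_asE vertex_bit_cons -mulgA.
by have [->|_] := eqVneq (g' * x) 1; rewrite ?mulg1 // vertex_bit_cons.
Qed.

Lemma team_shift u g al m : shift (fp_of g)^-1 (team_point u) al m = vertex_bit u g (fp_word al) m.
Proof. by rewrite /shift invgK /team_point word_of_mul vertex_bitM mul1g. Qed.

Lemma outcome_team_play u g : outcome j (team_play u g) = shift (fp_of g)^-1 (team_point u).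
Proof.
apply/funext => al; apply/funext => m; rewrite team_shift /outcome.
by rewrite /team_play odd_double doubleK.
Qed.

Definition visible t : seq (G j) :=
  pmap (fun n => if pselect (exists g, num (Tagged G g) = n) is left h
                 then Some (sval (cid h)) else None) (iota 0 t).

Lemma visibleP t g : num (Tagged G g) < t -> g \in visible t.
Proof.
move=> lt; rewrite mem_pmap; apply/mapP; exists (num (Tagged G g)); first by rewrite mem_iota.
case: pselect => [h|[]]; last by exists g.
by case: (cid h) => g' /= /num_inj/(congr1 in_factor); rewrite !in_factorE => ->.
Qed.

(** In each round bits are copied only across letters numbered below the round, so the first [t]
    rounds at [g] depend on the insertions at the finitely many [g * d] with [d] in this list. *)
Fixpoint sites t : seq (G j) :=
  if t is t'.+1 then
    1 :: sites t' ++ [seq g * d | g <- visible t', d <- sites t']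
  else [:: 1].

Lemma sites_le t t' d : t <= t' -> d \in sites t -> d \in sites t'.
Proof.
move=> /subnKC <-; elim: (t' - t) => [|n IH]; first by rewrite addn0.
by rewrite addnS /= inE mem_cat => /IH ->; rewrite orbT.
Qed.

(** Comparing two vertices gives equivariance of the solution, comparing two insertions gives its
    continuity and bounds what the strategy knows of the codes. *)
Lemma history_dep u u' t g g' :
  (forall d k l, d \in sites t -> (2 ^ k < t)%N -> u (g * d) k l = u' (g' * d) k l) ->
  history u t g = history u' t g'.
Proof.
elim: t g g' => //= t IH g g' H; congr (s (_ :: _)); last first.
  apply: IH => d k l dt kt; apply: H; last exact: ltnW.
  by rewrite inE mem_cat dt orbT.
apply/funext => -[|a w]; apply/funext => m /=.
  have [e|//] := eqVneq; have := H 1 (bit_code m).1.2 (bit_code m).2.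
  by rewrite !mulg1 inE eqxx e => ->.
have [e|//] := eqVneq; have [ea|//] := eqVneq (tag a) j; rewrite /=.
congr bit; apply: IH => d k l dt kt; rewrite -!mulgA; apply: H; last exact: ltnW.
rewrite inE mem_cat; apply/orP; right; apply/orP; right; apply: allpairs_f => //.
apply: visibleP; rewrite -e /turn weight_cons.
have -> : Tagged G (in_factor a) = a by case: a ea {e} => i x /= ei; subst i; rewrite in_factorE.
by rewrite -addnA addSn ltnS leq_addr.
Qed.

End TeamPlay.
End MarksGame.

(** * Borel payoffs *)

Lemma cvg_prod (J : Type) (K : topologicalType)
    (F : set_system (prod_topology (fun _ : J => K))) (y : prod_topology (fun _ : J => K)) :
  Filter F -> (forall i : J, (fun z : prod_topology (fun _ : J => K) => z i) @ F --> y i) ->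
  F --> y.
Proof.
move=> FF Hi; apply/cvg_sup => i U.
have /= -> := @nbhsE (initial_topology (fun f : prod_topology (fun _ : J => K) => f i)) y.
case=> B [[C oC <- /= Cy]] /filterS; apply; apply: Hi; exact: open_nbhs_nbhs.
Qed.

Section ShiftTopology.
Variable H : groupType.
Local Notation point := (shift_space cantor_space H).

Lemma cvg_bits (X : Type) (F : set_system X) (f : X -> point) (y : point) :
  Filter F -> (forall h m, \forall x \near F, f x h m = y h m) -> f @ F --> y.
Proof.
move=> FF Hb; apply: (@cvg_prod H cantor_space) => h.
apply: (@cvg_prod nat bool) => m.
move=> A /= /nbhs_singleton Am; rewrite /fmap /=.
by apply: filterS (Hb h m) => x /= ->.
Qed.

Lemma nbhs_bit (y : point) h m : nbhs y [set z : point | z h m = y h m].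
Proof.
have c1 := @proj_continuous H (fun=> cantor_space) h y.
have c2 := @proj_continuous nat (fun=> bool) m (y h).
have c : (fun z : point => z h m) @ y --> y h m by apply: cvg_comp c1 c2.
have := c [set y h m]; apply.
exact: discrete_set1.
Qed.

End ShiftTopology.

Section Payoff.
Variables (I : choiceType) (G : I -> groupType) (pl : nat -> option I).
Variable num : letter G -> nat.
Local Notation FP := (free_product G).
Local Notation point := (shift_space cantor_space FP).
Local Notation T := (marks_game G).
Variable j : I.

Definition payoff_class : set (set point) :=
  [set P | @unravelable T [set x | P (outcome pl num j x)]].

Lemma outcome_local (x x' : nat -> T) n al m : is_play x -> is_play x' -> x n = x' n ->
  (turn num (fp_word al) m).+1.*2 <= n -> outcome pl num j x al m = outcome pl num j x' al m.
Proof.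
move=> px px' e le; rewrite /outcome.
by rewrite -(play_ancestor px le) -(play_ancestor px' le) e.
Qed.

Lemma payoff_sigma : sigma_class payoff_class.
Proof.
split; first by apply: unravelable_open => x _ [].
- by move=> P; exact: unravelableC.
- by move=> F HF; exact: (unravelable_bigcup HF).
Qed.

Lemma payoff_bit h m b : payoff_class [set y | y h m = b].
Proof.
apply: unravelable_open => x px /= e; exists (turn num (fp_word h) m).+1.*2 => x' px' e'.
by rewrite -e; exact: (outcome_local px' px e').
Qed.

Lemma payoff_open (V : set point) : open V -> payoff_class V.
Proof.
move=> oV; apply: unravelable_open => x px Vx; apply: contrapT => no.
have /choice[x' Hx'] : forall n, exists x' : nat -> T,
    [/\ is_play x', x' n = x n & ~ V (outcome pl num j x')].
  move=> n; apply: contrapT => no'; apply: no; exists n => x' px' e.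
  by apply: contrapT => nV; apply: no'; exists x'.
have : (fun n => outcome pl num j (x' n)) @ \oo --> outcome pl num j x.
  apply: cvg_bits => h m; exists (turn num (fp_word h) m).+1.*2 => // n /= le.
  have [px' e _] := Hx' n; exact: (outcome_local px' px e).
move=> /(_ V); rewrite nbhsE => /(_ _)[]; first by exists V.
move=> N _ /(_ N (leqnn N)) /=; by have [] := Hx' N.
Qed.

Variable code : FP -> nat.
Hypothesis code_inj : injective code.

Lemma payoff_free : payoff_class (@free_part cantor_space FP).
Proof.
rewrite [X in payoff_class X](_ : _ = [set y | forall g : FP, g <> 1%g ->
  (~` [set y | shift g y = shift 1%g y]) y]).
  apply: (sc_all payoff_sigma code_inj) => g.
  apply: (sc_imp payoff_sigma); first exact: sc_cst payoff_sigma _.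
  apply: (scC payoff_sigma); apply: (B_eqshift payoff_sigma code_inj); exact: payoff_bit.
by apply/seteqP; split=> y /= H g /H; rewrite shift1.
Qed.

Lemma payoff_borel (A : set (Free cantor_space FP)) : Borel A ->
  payoff_class [set val x | x in A].
Proof.
pose C : set (set (Free cantor_space FP)) := [set A | payoff_class [set val x | x in A]].
apply: (@smallest_sub _ (sigma_algebra setT) _ C).
  split.
  - by rewrite /C /= image_set0; exact: sc0 payoff_sigma.
  - move=> P CP; rewrite /C /= setTD.
    rewrite [X in payoff_class X](_ : _ = [set y | free_part y /\ (~` [set val x | x in P]) y]).
      apply: (sc_and payoff_sigma) => //; first exact: payoff_free.
      exact: scC payoff_sigma _ _.
    apply/seteqP; split=> y /=.
      case=> x nPx <-; split; first exact: (set_mem (valP x)).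
      by case=> z Pz /val_inj e; apply: nPx; rewrite -e.
    case=> fy nP; exists (exist _ y (mem_set fy)) => // Py; apply: nP.
    by exists (exist _ y (mem_set fy)).
  - move=> F CF; rewrite /C /= image_bigcup; exact: sc_bigcup payoff_sigma _ _.
move=> U [V oV <-]; rewrite /C /=.
rewrite [X in payoff_class X](_ : _ = [set y | free_part y /\ V y]).
  by apply: (sc_and payoff_sigma); [exact: payoff_free | exact: payoff_open].
apply/seteqP; split=> y /=.
  by case=> x Vx <-; split=> //; exact: (set_mem (valP x)).
by case=> fy Vy; exists (exist _ y (mem_set fy)).
Qed.

End Payoff.

(** * Codes avoiding finitely many predictions *)

Lemma injective_surjection (T : Type) (f : T -> nat) (t0 : T) : injective f ->
  exists g : nat -> T, forall t, g (f t) = t.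
Proof.
move=> fI; have /choice[g Hg] : forall n, exists t, (exists t', f t' = n) -> f t = n.
  by move=> n; have [[t <-]|no] := pselect (exists t, f t = n); [exists t | exists t0].
by exists g => t; apply: fI; apply: Hg; exists t.
Qed.

(* A random choice of [c] violates each constraint with probability at most
   [1 / M], and [M] exceeds the number of constraints. *)
Lemma avoiding_code (S K : finType) (P : K -> Prop) (tgt : K -> S)
    (Psi : K -> (S -> nat -> bool) -> nat -> bool) :
  (forall k, P k -> forall c c', (forall s, s != tgt k -> c s = c' s) -> Psi k c = Psi k c') ->
  exists c, forall k, P k -> Psi k c <> c (tgt k).
Proof.
move=> HP; pose M := #|K|.+1.
pose e (i : 'I_M) : nat -> bool := fun n => n == i.
have eI : injective e.
  move=> i i' E; have := congr1 (fun f : nat -> bool => f i) E.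
  by rewrite /e eqxx => /esym/eqP ii'; exact: val_inj.
pose bad k : {set {ffun S -> 'I_M}} :=
  [set c : {ffun S -> 'I_M} | `[< P k /\ Psi k (e \o c) = e (c (tgt k)) >] ]%SET.
apply: contrapT => no.
have cover : forall c : {ffun S -> 'I_M}, exists k, c \in bad k.
  move=> c; apply: contrapT => no'; apply: no; exists (e \o c) => k Pk Ek.
  by apply: no'; exists k; rewrite inE; apply/asboolP.
(* A bad [c] is determined by its values off [tgt k], which fix the prediction; replacing its value
   at [tgt k] freely is therefore injective. *)
have small k : #|bad k| * M <= #|{ffun S -> 'I_M}|.
  pose F (cv : {ffun S -> 'I_M} * 'I_M) : {ffun S -> 'I_M} :=
    [ffun s => if s == tgt k then cv.2 else cv.1 s].
  have FI : {in finset.setX (bad k) [set: 'I_M]%SET &, injective F}.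
    move=> [c v] [c' v']; rewrite !inE /= => /andP[/asboolP[Pk Ec] _] /andP[/asboolP[_ Ec'] _] /ffunP EF.
    have ev : v = v' by have := EF (tgt k); rewrite !ffunE eqxx.
    have ec s : s != tgt k -> c s = c' s.
      by move=> ns; have := EF s; rewrite !ffunE (negbTE ns).
    have et : c (tgt k) = c' (tgt k).
      apply: eI; rewrite -Ec -Ec'; apply: (HP k Pk) => s ns; by rewrite /= ec.
    rewrite ev; congr pair; apply/ffunP => s.
    by have [->|ns] := eqVneq s (tgt k); [exact: et | exact: ec].
  rewrite -[X in _ * X](card_ord M) -[X in _ * X]cardsT -finset.cardsX -(card_in_imset FI).
  exact: max_card.
have le : #|{ffun S -> 'I_M}| <= \sum_k #|bad k|.
  rewrite -sum1_card; apply: (@leq_trans (\sum_(c : {ffun S -> 'I_M}) \sum_k (c \in bad k : nat))).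
    apply: leq_sum => c _; have [k ck] := cover c.
    by rewrite (bigD1 k) //= ck.
  rewrite exchange_big /=; apply: leq_sum => k _.
  by rewrite -sum1_card [X in _ <= X]big_mkcond /=; apply: leq_sum => c _; case: (c \in _).
have : #|{ffun S -> 'I_M}| * M <= #|K| * #|{ffun S -> 'I_M}|.
  apply: leq_trans (leq_mul le (leqnn M)) _; rewrite big_distrl /= -sum_nat_const.
  exact: leq_sum.
rewrite mulnC leq_pmul2r ?ltnn //; apply/card_gt0P; by exists [ffun=> ord0].
Qed.

(** * Locally constant invariants separating the points of an orbit *)

Section FreeShift.
Variables (H : groupType).
Local Notation Z := (Free cantor_space H).
Implicit Types (x y : Z) (g h d : H).
Local Open Scope group_scope.

Definition loc_const (S : Type) (phi : Z -> S) := forall x, \forall x' \near x, phi x' = phi x.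

Lemma loc_const_seq (J : eqType) (S : Type) (L : seq J) (phi : J -> Z -> S) x :
  (forall i, i \in L -> loc_const (phi i)) ->
  \forall x' \near x, forall i, i \in L -> phi i x' = phi i x.
Proof.
elim: L => [|a L IH] H1; first by apply: (@filterE _ (nbhs x)) => x' i; rewrite in_nil.
have ha : loc_const (phi a) by apply: H1; rewrite inE eqxx.
have hL : \forall x' \near x, forall i, i \in L -> phi i x' = phi i x.
  by apply: IH => i iL; apply: H1; rewrite inE iL orbT.
apply: (@filterS2 _ (nbhs x)) (ha x) hL => x' e1 e2 i; rewrite inE => /orP[/eqP->//|]; exact: e2.
Qed.

Lemma loc_const_lt (S : Type) (phi : nat -> Z -> S) n x :
  (forall i, loc_const (phi i)) -> \forall x' \near x, forall i, i < n -> phi i x' = phi i x.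
Proof.
move=> H1; have := @loc_const_seq nat S (iota 0 n) phi x (fun i _ => H1 i).
by apply: filterS => x' E i lt; apply: E; rewrite mem_iota.
Qed.

Lemma free_shiftM g h x : free_shift g (free_shift h x) = free_shift (g * h) x.
Proof. by apply: val_inj; rewrite /= shiftM. Qed.

Lemma free_shift1 x : free_shift 1 x = x.
Proof. by apply: val_inj; rewrite /= shift1. Qed.

Lemma free_shift_free g x : g <> 1 -> free_shift g x <> x.
Proof. by move=> g1 /(congr1 val); exact: (set_mem (valP x) g g1). Qed.

Lemma loc_const_bit h m : loc_const (fun x => val x h m).
Proof.
move=> x; have := @initial_continuous _ _ (@set_val _ (@free_part cantor_space H)) x.
by move=> /(_ _ (nbhs_bit (val x) h m)).
Qed.

Section Descent.
Variables (c : Z -> nat) (st : H).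
Hypothesis clc : forall g, loc_const (fun x => c (free_shift g x)).

(** Parity of the length of the run along [st] on which [c] decreases. The colour bounds this
    length, so [n] is fuel. *)
Fixpoint descent_parity n x : bool :=
  if n is n'.+1 then
    if c (free_shift st x) < c x then ~~ descent_parity n' (free_shift st x) else false
  else false.

(* If [c] separates [x] from [st x] then so does one of the two parities along
   [st] and along [st^-1], according to the direction in which [c] decreases. *)
Definition parity x := descent_parity (c x) x.

Lemma descent_parityE n m x : c x <= n -> c x <= m ->
  descent_parity n x = descent_parity m x.
Proof.
elim: n m x => [|n IH] [|m] x //=; rewrite ?leqn0.
- by move=> /eqP-> _.
- by move=> _ /eqP->.
- move=> xn xm; case: ifP => // lt; congr (~~ _); apply: IH; rewrite -ltnS.
    exact: leq_trans xn.
  exact: leq_trans xm.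
Qed.

Lemma parityE x : c (free_shift st x) < c x -> parity x = ~~ parity (free_shift st x).
Proof.
move=> lt; have -> : parity x = descent_parity (c x).-1.+1 x.
  by rewrite prednK //; apply: leq_ltn_trans lt.
rewrite /= lt; congr (~~ _); apply: descent_parityE => //.
by rewrite -ltnS prednK //; apply: leq_ltn_trans lt.
Qed.

Lemma loc_const_descent n g : loc_const (fun x => descent_parity n (free_shift g x)).
Proof.
elim: n g => [|n IH] g x; first exact: (@filterE _ (nbhs x)).
have h1 := clc g x; have h2 := clc (st * g) x; have h3 := IH (st * g) x.
apply: (@filterS3 _ (nbhs x)) h1 h2 h3 => x' e1 e2 e3.
by rewrite /= free_shiftM e1 e2 e3 free_shiftM.
Qed.

Lemma loc_const_parity g : loc_const (fun x => parity (free_shift g x)).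
Proof.
move=> x; apply: (@filterS2 _ (nbhs x)) (clc g x) (loc_const_descent (c (free_shift g x)) g x) => x' e1 e2.
by rewrite /parity e1 e2.
Qed.

End Descent.

Variables (elt_of : nat -> H).
Hypothesis elt_of_surj : forall h, exists n, elt_of n = h.

Definition xbit n x : bool := let: (a, b) := odflt (0, 0)%N (unpickle n) in val x (elt_of a) b.

Lemma xbit_inj x y : (forall n, xbit n x = xbit n y) -> x = y.
Proof.
move=> E; apply: val_inj; apply/funext => h; apply/funext => m.
have [a <-] := elt_of_surj h; by have := E (pickle (a, m)); rewrite /xbit pickleK.
Qed.

Lemma loc_const_xbit n g : loc_const (fun x => xbit n (free_shift g x)).
Proof. by rewrite /xbit; case: (odflt _ _) => a b; exact: loc_const_bit. Qed.

Definition first_diff d x : nat :=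
  if pselect (exists n, xbit n x != xbit n (free_shift d x)) is left h then ex_minn h else 0%N.

(** A Cole-Vishkin colour: if [x] and its translate shared it, they would first differ from their
    translates at the same index and agree there. *)
Definition diff_color d x : nat := (first_diff d x).*2 + xbit (first_diff d x) x.

Lemma first_diffP d x : d <> 1 -> xbit (first_diff d x) x != xbit (first_diff d x) (free_shift d x) /\
  forall n, n < first_diff d x -> xbit n x = xbit n (free_shift d x).
Proof.
move=> d1; rewrite /first_diff; case: pselect => [h|no].
  case: ex_minnP => n nx nm; split=> // i lt; apply/eqP/negPn/negP => /nm; by rewrite leqNgt lt.
case: (free_shift_free (x := x) d1); apply: xbit_inj => n; apply/eqP/negPn/negP => ne.
by apply: no; exists n; rewrite eq_sym.
Qed.

Lemma diff_color_neq d x : d <> 1 -> diff_color d x <> diff_color d (free_shift d x).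
Proof.
move=> d1 e; have [ne _] := first_diffP x d1.
have e1 : first_diff d x = first_diff d (free_shift d x).
  have := congr1 half e; rewrite /diff_color.
  by rewrite ![_.*2 + _]addnC !half_bit_double.
have := congr1 odd e; rewrite /diff_color !oddD !odd_double -e1 /= => /eqP.
by case: (xbit _ _) ne; case: (xbit _ _).
Qed.

Lemma loc_const_diff_color d g : d <> 1 -> loc_const (fun x => diff_color d (free_shift g x)).
Proof.
move=> d1 x; set n := first_diff d (free_shift g x).
have h1 := loc_const_lt n.+1 x (fun i => @loc_const_xbit i g).
have h2 := loc_const_lt n.+1 x (fun i => @loc_const_xbit i (d * g)).
apply: (@filterS2 _ (nbhs x)) h1 h2 => x' e1 e2.
have [ne eqs] := first_diffP (free_shift g x) d1; rewrite -/n free_shiftM in ne eqs.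
have [ne' eqs'] := first_diffP (free_shift g x') d1; rewrite free_shiftM in ne' eqs'.
have en : first_diff d (free_shift g x') = n.
  apply/eqP; rewrite eqn_leq; apply/andP; split; rewrite leqNgt; apply/negP => lt.
    by move: ne; rewrite -e1 // -e2 // eqs' // eqxx.
  by move: ne'; rewrite e1 1?ltnW // e2 1?ltnW // eqs // eqxx.
by rewrite /diff_color en e1.
Qed.

(* The sequence [info] determines [x], and, by the parities, a number of bits
   depending on [d] only separates [x] from its translate by [d]. *)
Definition info n x : bool :=
  let: (t, a, b) := odflt (0, 0, 0)%N (unpickle n) in
  let d := elt_of a in
  if t == 0%N then xbit b x
  else if pselect (d = 1) then false
  else if t == 1%N then parity (diff_color d) d x
  else parity (diff_color d) d^-1 x.

Lemma loc_const_info n g : loc_const (fun x => info n (free_shift g x)).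
Proof.
rewrite /info; case: (odflt _ _) => [[t a] b]; case: (t == 0%N); first exact: loc_const_xbit.
case: (pselect (elt_of a = 1)) => [_|d1] /=; first by move=> x; exact: (@filterE _ (nbhs x)).
by case: (t == 1%N); apply: loc_const_parity => h; exact: loc_const_diff_color.
Qed.

Lemma info_inj x y : (forall n, info n x = info n y) -> x = y.
Proof.
move=> E; apply: xbit_inj => b; by have := E (pickle (0, 0, b)%N); rewrite /info pickleK.
Qed.

(** The bound is uniform in [x], unlike the first differing bit; this lets the length of the symbols
    be fixed in advance. *)
Lemma info_separated d : d <> 1 -> exists N, forall x,
  exists n, n < N /\ info n x <> info n (free_shift d x).
Proof.
move=> d1; have [a ea] := elt_of_surj d.
pose n1 : nat := pickle (1, a, 0)%N; pose n2 : nat := pickle (2, a, 0)%N.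
exists (maxn n1 n2).+1 => x.
have i1 y : info n1 y = parity (diff_color d) d y.
  by rewrite /info pickleK /= ea; case: pselect.
have i2 y : info n2 y = parity (diff_color d) d^-1 y.
  by rewrite /info pickleK /= ea; case: pselect.
have := diff_color_neq (x := x) d1; have [lt _|lt _|-> []//] := ltngtP (diff_color d (free_shift d x)) (diff_color d x).
  exists n1; rewrite ltnS leq_maxl !i1; split=> //.
  by rewrite (parityE lt); case: (parity _ _ _).
exists n2; rewrite ltnS leq_maxr !i2; split=> //.
have e : free_shift d^-1 (free_shift d x) = x by rewrite free_shiftM mulVg free_shift1.
have := @parityE (diff_color d) d^-1 (free_shift d x).
by rewrite e => /(_ lt) ->; case: (parity _ _ _).
Qed.

End FreeShift.

(** * Coding a free point into the moves of one player *)

Section Coding.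
Variables (I : choiceType) (G : I -> groupType) (pl : nat -> option I).
Variable num : letter G -> nat.
Hypothesis num_inj : injective num.
Local Notation FP := (free_product G).
Local Notation point := (shift_space cantor_space FP).
Local Notation T := (marks_game G).
Variables (j : I) (i0 : nat) (s : T -> T) (elt_of : nat -> G j).
Hypotheses (pl0 : pl i0 = Some j) (vs : valid s).
Hypothesis elt_of_surj : forall h, exists n, elt_of n = h.
Local Notation Z := (Free cantor_space (G j)).
Implicit Types (x y : Z) (g d : G j) (w : seq (letter G)) (k l n : nat).
Implicit Types (u : G j -> nat -> nat -> bool) (p : G j -> seq bool).
Implicit Types (c : nat -> seq bool -> nat -> bool) (t : seq bool).
Local Open Scope group_scope.
Local Notation dinfo := (info elt_of).
Local Notation vbit := (vertex_bit pl num s).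

Definition light_letters n : seq (letter G) :=
  pmap (fun m => if pselect (exists a, num a = m) is left h
                 then Some (sval (cid h)) else None) (iota 0 n).

Lemma light_lettersP n a : num a < n -> a \in light_letters n.
Proof.
move=> lt; rewrite mem_pmap; apply/mapP; exists (num a); first by rewrite mem_iota.
case: pselect => [h|[]]; last by exists a.
by case: (cid h) => b /= /num_inj ->.
Qed.

Fixpoint light_words n : seq (seq (letter G)) :=
  if n is n'.+1 then [::] :: [seq a :: w | a <- light_letters n, w <- light_words n']
  else [::].

Lemma light_wordsP n w : weight num w < n -> w \in light_words n.
Proof.
elim: n w => // n IH [|a w]; first by rewrite inE eqxx.
rewrite weight_cons addSn ltnS => lt; rewrite /= inE; apply/orP; right.
apply: allpairs_f; last by apply: IH; apply: leq_ltn_trans (leq_addl _ _) lt.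
by apply: light_lettersP; rewrite ltnS; apply: leq_trans (leq_addr _ _) (ltnW lt).
Qed.

(** A bit of block [k] at a word lighter than [2 ^ k] is played before round [2 ^ k.+1], when block
    [k.+1] starts. *)
Definition window k : seq (G j) := sites num j (2 ^ k.+1)%N.

Lemma window_dep u u' w k l : (weight num w < 2 ^ k)%N ->
  (forall d k' l', d \in window k -> k' <= k -> u d k' l' = u' d k' l') ->
  vbit u 1 w (code_bit i0 k l) = vbit u' 1 w (code_bit i0 k l).
Proof.
move=> lw E; rewrite /vertex_bit; congr bit; apply: history_dep => // d k' l' dw lk.
have lt : ((turn num w (code_bit i0 k l)).+1 <= 2 ^ k.+1)%N.
  by rewrite /turn code_bitK /= expnS mul2n -addnn ltn_add2r.
rewrite !mul1g; apply: E; first exact: sites_le lt dw.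
by rewrite -ltnS -(@ltn_exp2l 2) //; exact: leq_trans lk lt.
Qed.

Lemma separation_depth (L : seq (G j)) : exists N, forall g g' x, g \in L -> g' \in L ->
  g <> g' -> exists n, n < N /\ dinfo n (free_shift g^-1 x) <> dinfo n (free_shift g'^-1 x).
Proof.
have /choice[N HN] : forall d, exists N, d <> 1 -> forall x,
    exists n, n < N /\ dinfo n x <> dinfo n (free_shift d x).
  move=> d; have [->|/eqP d1] := eqVneq d 1; first by exists 0.
  by have [N HN] := info_separated elt_of_surj d1; exists N.
exists (\max_(q <- [seq (g, g') | g <- L, g' <- L]) N (q.2^-1 * q.1)%g).
move=> g g' x gL gL' ne; have d1 : g'^-1 * g <> 1.
  by move=> e; apply: ne; rewrite -[g](mulVKg g') e mulg1.
have [n [ltn Hn]] := HN _ d1 (free_shift g^-1 x); exists n; split.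
  apply: leq_trans ltn _.
  have := @leq_bigmax_seq _ [seq (g, g') | g <- L, g' <- L] xpredT
    (fun q : G j * G j => N (q.2^-1 * q.1)) (g, g').
  by apply=> //; exact: allpairs_f.
by rewrite free_shiftM mulgK in Hn.
Qed.

Definition sep_depth k : nat := sval (cid (separation_depth (window k))).

(** The sum makes [depth] monotone and the added ones make it exceed [k]. The index [i.+1] lets
    stage [k] separate the next window, so that elements found at consecutive stages can be
    compared. *)
Definition depth k := \sum_(i < k.+1) (sep_depth i.+1).+1.

Lemma depth_mono k k' : k <= k' -> depth k <= depth k'.
Proof.
move=> /subnKC <-; elim: (k' - k) => [|n IH]; first by rewrite addn0.
by rewrite addnS; apply: leq_trans IH _; rewrite /depth [X in _ <= X]big_ord_recr leq_addr.
Qed.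

Lemma depth_gt k : k < depth k.
Proof.
elim: k => [|k IH]; first by rewrite /depth big_ord_recr /= addnS.
by rewrite /depth big_ord_recr /= addnS ltnS; apply: leq_trans IH (leq_addr _ _).
Qed.

Lemma depth_separates k g g' x : g \in window k.+1 -> g' \in window k.+1 ->
  (forall n, n < depth k -> dinfo n (free_shift g^-1 x) = dinfo n (free_shift g'^-1 x)) -> g = g'.
Proof.
move=> gw gw' E; apply: contrapT => ne.
have [n [ltn]] := svalP (cid (separation_depth (window k.+1))) g g' x gw gw' ne; apply; apply: E.
apply: leq_trans ltn _; rewrite /depth big_ord_recr /=.
by apply: leq_trans (leqnSn _) (leq_addl _ _).
Qed.

Definition coded c p : G j -> nat -> nat -> bool :=
  fun d k l => c k (take (depth k) (p d)) l.

(* When the [k]-th symbols seen in the window all differ from [t], the strategy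
   does not predict the code of [t] at the place of the identity of another
   orbit of the factor. *)
Definition coding_ok k c :=
  (forall t t', size t = depth k -> size t' = depth k -> t <> t' -> c k t <> c k t') /\
  (forall w p t, (weight num w < 2 ^ k)%N -> (forall d, d \in window k -> size (p d) = depth k) ->
    size t = depth k -> (forall d, d \in window k -> p d <> t) ->
    (fun l => vbit (coded c p) 1 w (code_bit i0 k l)) <> c k t).

Definition update c k (ck : seq bool -> nat -> bool) : nat -> seq bool -> nat -> bool :=
  fun k' => if k' == k then ck else c k'.

Lemma coding_step k c : exists ck, coding_ok k (update c k ck).
Proof.
pose S := (depth k).-tuple bool; pose L := light_words (2 ^ k).
pose t0 : S := [tuple of nseq (depth k) false].
pose ext (f : S -> nat -> bool) : seq bool -> nat -> bool := fun t => f (insubd t0 t).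
pose pat (q : (size (window k)).-tuple S) : G j -> seq bool :=
  fun d => tval (nth t0 q (index d (window k))).
have extE f (t : S) : ext f t = f t by rewrite /ext valKd.
have patE q d : size (pat q d) = depth k by rewrite size_tuple.
(* A left constraint asks for distinct codes of two symbols; a right one consists of a light word, a
   pattern of symbols on the window and a symbol outside the pattern. Neither prediction involves
   the code of the symbol it is compared with. *)
pose K := ((S * S) + ('I_(size L) * (size (window k)).-tuple S * S))%type.
pose P (q : K) := match q with
  | inl r => r.1 <> r.2
  | inr r => (weight num (nth [::] L r.1.1) < 2 ^ k)%N /\ r.2 \notin (r.1.2 : seq S)
  end.
pose tgt (q : K) := match q with inl r => r.2 | inr r => r.2 end.
pose Psi (q : K) f : nat -> bool := match q with
  | inl r => f r.1
  | inr r => fun l => vbit (coded (update c k (ext f)) (pat r.1.2)) 1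
      (nth [::] L r.1.1) (code_bit i0 k l)
  end.
have [|f Hf] := @avoiding_code S K P tgt Psi.
  case=> [[t t'] /= /eqP ne f f' E|[[iw q] t'] /= [lw nt] f f' E]; first exact: E.
  apply/funext => l; apply: window_dep => // d k' l' dw _; rewrite /coded /update.
  have [->|//] := eqVneq k' k; rewrite take_oversize ?patE // /pat !extE E //.
  apply: contraNneq nt => <-; apply: mem_nth; by rewrite size_tuple index_mem.
exists (ext f); split=> [t t' st st' ne|w p t lw sp st ne].
  have e r (sr : size r = depth k) : r = tval (insubd t0 r).
    by rewrite insubdK //; exact/eqP.
  rewrite /update eqxx (e t st) (e t' st') !extE.
  apply: (Hf (inl (insubd t0 t, insubd t0 t'))) => /= E; apply: ne.
  by rewrite (e t st) (e t' st') E.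
have e r (sr : size r = depth k) : r = tval (insubd t0 r).
  by rewrite insubdK //; exact/eqP.
have wL' := light_wordsP lw; have wL := wL'; rewrite -/L -index_mem in wL.
pose q : (size (window k)).-tuple S := [tuple of map (fun d => insubd t0 (p d)) (in_tuple (window k))].
have pq d : d \in window k -> pat q d = p d.
  move=> dw; rewrite /pat /= (nth_map 1) ?index_mem // nth_index //.
  by rewrite -e // sp.
have := Hf (inr (Ordinal wL, q, insubd t0 t)); rewrite /= (nth_index _ wL').
have -> : update c k (ext f) k t = f (insubd t0 t) by rewrite /update eqxx /ext.
have -> : (fun l => vbit (coded (update c k (ext f)) (pat q)) 1 w (code_bit i0 k l)) =
  (fun l => vbit (coded (update c k (ext f)) p) 1 w (code_bit i0 k l)).
  by apply/funext => l; apply: window_dep => // d k' l' dw _; rewrite /coded pq.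
apply; split=> //; apply/negP => iq.
have /mapP[d dw E] : insubd t0 t \in map (fun d => insubd t0 (p d)) (window k) by exact: iq.
apply: (ne d dw).
by rewrite (e t st) E -e // sp.
Qed.

(** By [window_dep], [coding_ok k] involves only the codes up to [k], so they can be chosen
    recursively. *)
Lemma coding_ex : exists c, forall k, coding_ok k c.
Proof.
have st kc : {ck | coding_ok kc.1 (update kc.2 kc.1 ck)} by exact/cid/coding_step.
pose fix C n : nat -> seq bool -> nat -> bool :=
  if n is n'.+1 then update (C n') n' (sval (st (n', C n'))) else fun _ _ _ => false.
pose c k := C k.+1 k; exists c => k.
have CE n k' : k' < n -> C n k' = c k'.
  move=> /subnKC <-; elim: (n - _) => [|m IH]; first by rewrite addn0.
  by rewrite addnS -IH /= /update ifF //; apply/negbTE; rewrite neq_ltn addSn ltnS leq_addr.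
have [h1 h2] := svalP (st (k, C k)); rewrite /= in h1 h2.
split; first exact: h1.
move=> w p t lw sp stk ne; have := h2 w p t lw sp stk ne.
suff -> : (fun l => vbit (coded c p) 1 w (code_bit i0 k l)) =
  (fun l => vbit (coded (C k.+1) p) 1 w (code_bit i0 k l)) by [].
by apply/funext => l; apply: window_dep => // d k' l' _ kk; rewrite /coded -(CE k.+1).
Qed.

Definition code := sval (cid coding_ex).

Definition symbol k x : seq bool := mkseq (dinfo ^~ x) (depth k).

Definition encoded x : G j -> nat -> nat -> bool :=
  fun g k l => code k (symbol k (free_shift g^-1 x)) l.

Definition solution x : point := team_point pl num s (encoded x).

Lemma size_symbol k x : size (symbol k x) = depth k. Proof. exact: size_mkseq. Qed.

Lemma symbolP k x y : symbol k x = symbol k y <-> forall n, n < depth k -> dinfo n x = dinfo n y.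
Proof.
split=> [E n lt|E]; last first.
  by apply/eq_in_map => n; rewrite mem_iota /= add0n; exact: E.
by have := congr1 (fun t => nth false t n) E; rewrite !nth_mkseq.
Qed.

Lemma take_symbol k k' x : k' <= k -> take (depth k') (symbol k x) = symbol k' x.
Proof.
move=> le; rewrite /symbol /mkseq -map_take take_iota; congr (map _ (iota _ _)).
by apply/minn_idPl; exact: depth_mono.
Qed.

Lemma solution_equivariant g x : solution (free_shift g x) = shift (fp_of g) (solution x).
Proof.
apply/funext => al; apply/funext => m.
have := team_shift pl num vs (encoded x) g^-1 al m; rewrite -gmulfV invgK => ->.
rewrite /solution /team_point /vertex_bit; congr bit; apply: history_dep => // d k l _ _.
by rewrite /encoded free_shiftM mul1g invgM invgK.
Qed.

Lemma solution_identity x k l : solution x 1 (code_bit i0 k l) = code k (symbol k x) l.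
Proof. by rewrite /solution /team_point vertex_bit_nil // /encoded invg1 free_shift1. Qed.

Lemma solution_inj : injective solution.
Proof.
move=> x y E; apply: (info_inj elt_of_surj) => n.
apply: (symbolP n x y).1 => [|]; last exact: depth_gt.
apply: contrapT => ne; have [h1 _] := svalP (cid coding_ex) n.
apply: (h1 _ _ (size_symbol _ _) (size_symbol _ _) ne).
by apply/funext => l; rewrite -/code -!solution_identity E.
Qed.

Lemma solution_loc_const al m : loc_const (fun x => solution x al m).
Proof.
move=> x; set t := (turn num (fp_word al) m).+1.
pose phi (dk : G j * nat) (y : Z) := symbol dk.2 (free_shift dk.1^-1 y).
have lphi dk : loc_const (phi dk).
  move=> y; have := @loc_const_lt _ _ _ (depth dk.2) y (fun n => @loc_const_info _ elt_of elt_of_surj n dk.1^-1).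
  by apply: (@filterS _ (nbhs y)) => y' E; apply/symbolP.
have := @loc_const_seq _ _ _ [seq (d, k) | d <- sites num j t, k <- iota 0 t] phi x (fun dk _ => lphi dk).
apply: (@filterS _ (nbhs x)) => y E; rewrite /solution /team_point /vertex_bit -/t.
congr bit; apply: history_dep => // d k l dt kt; rewrite !mul1g /encoded; congr (code _ _ _).
apply: (E (d, k)); apply: allpairs_f => //; rewrite mem_iota /= add0n.
by apply: leq_trans kt; rewrite ltnS ltnW // ltn_expl.
Qed.

(* If [solution y] is a translate of [solution x], then at every stage the symbol
   of [y] is that of some translate of [x] by an element of the window, and by
   [depth_separates] this element is eventually constant. *)
Lemma solution_reduction al x y : shift al (solution x) = solution y ->
  exists g, free_shift g x = y.
Proof.
(* The bits of [solution y] at the identity are those of [solution x] at this word. *)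
move=> E; pose w := fp_word (al^-1 : FP).
pose k0 := weight num w.
have lk k : k0 <= k -> (weight num w < 2 ^ k)%N.
  by move=> le; apply: leq_ltn_trans le _; exact: ltn_expl.
have near k : k0 <= k -> exists g, g \in window k /\ symbol k (free_shift g^-1 x) = symbol k y.
  move=> le; apply: contrapT => no; have [_ h2] := svalP (cid coding_ex) k.
  apply: (h2 w (fun d => symbol k (free_shift d^-1 x)) (symbol k y) (lk k le)).
  - by move=> d _; exact: size_symbol.
  - exact: size_symbol.
  - by move=> d dw e; apply: no; exists d.
  apply/funext => l; rewrite -/code -solution_identity -E /shift mulg1.
  rewrite /solution /team_point; apply: window_dep => [|d k' l' _ kk]; first exact: lk.
  by rewrite /coded /encoded take_symbol.
have /choice[gam Hg] : forall k, exists g, k0 <= k ->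
    g \in window k /\ symbol k (free_shift g^-1 x) = symbol k y.
  by move=> k; have [/near[g Hg]|_] := leqP k0 k; [exists g | exists 1].
have stab k : k0 <= k -> gam k.+1 = gam k.
  move=> le; have [w1 e1] := Hg k le; have [w2 e2] := Hg k.+1 (leqW le).
  apply: (@depth_separates k _ _ x) => //.
    by apply: sites_le w1; rewrite leq_exp2l.
  move=> n lt; have /symbolP e1' := e1; have /symbolP e2' := e2.
  by rewrite e1' // e2' //; apply: leq_trans lt (depth_mono (leqnSn k)).
have stab' k : k0 <= k -> gam k = gam k0.
  by move=> /subnKC <-; elim: (k - k0) => [|n IH]; rewrite ?addn0 // addnS stab ?leq_addr.
exists (gam k0)^-1; apply: (info_inj elt_of_surj) => n.
have le : k0 <= maxn k0 n by rewrite leq_maxl.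
have [_ /symbolP e] := Hg _ le; rewrite -(stab' _ le); apply: e.
by apply: leq_ltn_trans (depth_gt _); rewrite leq_maxr.
Qed.

End Coding.

(** * The theorem *)

Lemma continuous_Borel (S R : topologicalType) (f : S -> R) : continuous f -> Borel_function f.
Proof.
move=> /continuousP cf B; pose C := [set B : set R | Borel (f @^-1` B)].
apply: (@smallest_sub _ (sigma_algebra setT) _ C); last first.
  by move=> U oU; apply: sub_sigma_algebra; exact: cf.
split=> [|P CP|F CF]; rewrite /C /= ?preimage_set0 /Borel.
- exact: sigma_algebra0.
- by rewrite setTD preimage_setC -setTD; exact: sigma_algebraCD.
- by rewrite preimage_bigcup; exact: sigma_algebra_bigcup.
Qed.

Lemma letter_code (I : countType) (G : I -> groupType) :
  (forall i, countable [set: G i]) -> exists num : letter G -> nat, injective num.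
Proof.
move=> cG; have f i : {f : G i -> nat | injective f}.
  by apply: cid; have /countable_injP[f fI] := cG i; exists f => x y; apply: fI; exact: in_setT.
exists (fun a => pickle (pickle (tag a), sval (f (tag a)) (tagged a))) => -[i x] [i' x'] /=.
move/(pcan_inj (@pickleK _)) => -[/(pcan_inj (@pickleK _)) e]; case: _ / e x' => x'.
by move=> /(svalP (f _)) ->.
Qed.

Definition to_free (H : groupType) (y : shift_space cantor_space H) (h : free_part y) :
  Free cantor_space H := exist _ y (mem_set h).

Lemma free_part_inv (H : groupType) (g : H) (y : shift_space cantor_space H) :
  free_part (shift g y) -> free_part y.
Proof.
move=> fy; have /set_mem := free_part_shift g^-1%g (to_free fy).
by rewrite /= -shiftM mulVg shift1.
Qed.

Section Main.
Variables (I : option nat) (Gamma : index_type I -> groupType).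
Local Notation FP := (free_product Gamma).
Local Notation point := (shift_space cantor_space FP).
Variables (A : index_type I -> set (Free cantor_space FP)) (dec : nat -> FP * seq (FP * nat * bool)).

Definition payoff j : set point :=
  [set y | [set val x | x in A j] y \/ (~` @free_part cantor_space FP) y /\ color dec y j].

End Main.

Theorem theorem1p2 (I : option nat) (Gamma : index_type I -> groupType)
    (Gamma_countable : forall i, countable [set: Gamma i])
    (A : index_type I -> set (Free cantor_space (free_product Gamma)))
    (A_partition : Borel_partition A) :
  exists (j : index_type I)
    (f : Free cantor_space (Gamma j) -> Free cantor_space (free_product Gamma)),
    [/\ injective f,
        continuous f,
        equivariant (@fp_of _ Gamma j) f,
        range f `<=` A j &
        Borel_reduction (@orbit_rel cantor_space (Gamma j))
                        (@orbit_rel cantor_space (free_product Gamma)) f].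
Proof.
case: A_partition => bA _ cA.
have [num num_inj] := letter_code Gamma_countable.
pose cde (x : free_product Gamma) : nat := pickle [seq num a | a <- fp_word x].
have cde_inj : injective cde.
  by move=> x y /(pcan_inj (@pickleK _))/(inj_map num_inj) /val_inj.
have [dec dec_surj] : exists dec : nat -> free_product Gamma * seq (free_product Gamma * nat * bool), forall l, exists k, dec k = l.
  pose enc (l : free_product Gamma * seq (free_product Gamma * nat * bool)) : nat :=
    pickle (cde l.1, [seq (cde t.1.1, t.1.2, t.2) | t <- l.2]).
  have enc_inj : injective enc.
    move=> [u t] [u' t'] /(pcan_inj (@pickleK _)) [/cde_inj -> /inj_map ->] //.
    by move=> [[h m] b] [[h' m'] b'] [/cde_inj -> -> ->].
  have [dec decK] := injective_surjection (1%g : free_product Gamma, [::]) enc_inj.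
  by exists dec => l; exists (enc l).
(* Identity bits with a number outside the index set have no owner: they belong to the team in every
   game and are false in the joint play. *)
pose pl : nat -> option (index_type I) := insub; pose T := marks_game Gamma.
have plE j : pl (val j) = Some j by exact: valK.
have cover y : exists j, payoff A dec j y.
  have [fy|nfy] := pselect (free_part y).
    have : cover setT A (to_free fy) by rewrite cA.
    by case=> j _ Aj; exists j; left; exists (to_free fy).
  have [g g1 gy] : exists2 g : free_product Gamma, g <> 1%g & shift g y = y.
    by apply: contrapT => no; apply: nfy => g g1 e; apply: no; exists g.
  by have [j cj] := color_exists dec_surj g1 gy; exists j; right.
have det j : @unravelable T [set x | ~ payoff A dec j (outcome pl num j x)].
  apply: (@unravelableC T [set x | payoff A dec j (outcome pl num j x)]).
  have sg := payoff_sigma pl num j.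
  have : payoff_class pl num j (payoff A dec j); last by [].
  apply: (sc_or sg); first exact: (payoff_borel pl num j cde_inj (bA j)).
  apply: (sc_and sg); first by apply: (scC sg); exact: (payoff_free pl num j cde_inj).
  by apply: (B_color dec sg cde_inj) => h m b; exact: payoff_bit.
have [j [s vs Hs]] : exists j, exists2 s : T -> T, valid s &
    forall x, is_play x -> follows true s 0 x -> payoff A dec j (outcome pl num j x).
  apply: contrapT => no.
  have /choice[s Hs] : forall j, exists s : T -> T, valid s /\
      forall x, is_play x -> follows false s 0 x -> ~ payoff A dec j (outcome pl num j x).
    move=> j; have [[s vs Hs]|[s vs Hs]] := unravelable_determined (det j); first by exists s.
    by case: no; exists j, s => // x px fx; apply: contrapT; exact: Hs.
  have vs i := (Hs i).1; have [j] := cover (joint_point pl num s).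
  rewrite -(outcome_joint pl num vs j); apply: (Hs j).2; first exact: joint_play_play.
  exact: joint_play_follows.
have [elt_of elt_of_surj] : exists elt_of : nat -> Gamma j, forall h, exists n, elt_of n = h.
  have fI : injective (fun g : Gamma j => num (Tagged Gamma g)).
    by move=> g h /num_inj/(congr1 (@in_factor _ _ j)); rewrite !in_factorE.
  have [elt_of K] := injective_surjection (1%g : Gamma j) fI.
  by exists elt_of => h; eexists; exact: K.
pose F := solution pl num_inj (val j) s elt_of_surj.
have F_inj : injective F by exact: (@solution_inj _ _ _ _ num_inj _ _ _ _ (plE j) vs elt_of_surj).
have F_eq g x : F (free_shift g x) = shift (fp_of g) (F x) by exact: solution_equivariant.
have F_pay x (g : Gamma j) : payoff A dec j (shift (fp_of g) (F x)).
  have := Hs _ (team_play_play pl num vs (encoded pl num_inj (val j) s elt_of_surj x) g^-1%g)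
    (team_play_follows pl num s _ g^-1%g).
  by rewrite (outcome_team_play pl num vs) gmulfV invgK.
have F_free x : free_part (F x).
  (* Being injective and equivariant, [F] makes [Gamma j] act freely on the orbit of [F x]. If [F x]
     were not free, no translate of it would be, and all would have colour [j]. *)
  apply: contrapT => nf; apply: (@color_avoid _ _ dec (F x) j).
    move=> g g1; rewrite -F_eq => /F_inj; exact: free_shift_free.
  move=> g; have [[x0 _ e]|[]//] := F_pay x g.
  by case: nf; apply: (free_part_inv (g := fp_of g)); rewrite -e; exact: (set_mem (valP x0)).
pose f x : Free cantor_space (free_product Gamma) := to_free (F_free x).
have f_cont : continuous f.
  move=> x U; have /= -> := @nbhsE (initial_topology (@set_val _ (@free_part cantor_space (free_product Gamma)))) (f x).
  have FF : Filter (f @ x) := fmap_filter f (nbhs_filter x).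
  case=> B [[C oC <- Cx]] /filterS; apply.
  have cF : F @ x --> F x by apply: (@cvg_bits _ _ (nbhs x)) => h m; exact: solution_loc_const.
  exact: (cF C (open_nbhs_nbhs (conj oC Cx))).
have f_eq : equivariant (@fp_of _ Gamma j) f by move=> g x; apply: val_inj; exact: F_eq.
exists j, f; split=> //.
- by move=> x y /(congr1 val); exact: F_inj.
- move=> _ [x _ <-]; have := F_pay x 1%g; rewrite gmulf1 shift1.
  case=> [[x0 Ax0 e]|[nf]]; last by case: (nf (F_free x)).
  by have -> : f x = x0 by apply: val_inj.
split=> [|x y]; first exact: continuous_Borel.
split=> [[g <-]|[g /(congr1 val) /= e]]; first by exists (fp_of g); rewrite f_eq.
exact: (solution_reduction (plE j) vs e).
Qed.
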